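(* Let $d\ge2$. The set $$\mathcal E_d=\{p>0:\ p\notin2\mathbb N,\ \text{every }\mu\in\mathcal M_p\text{ has finite support}\}$$ is dense in $(0,\infty)$.
   Context: $\mathbb S^{d-1}$ is the real unit sphere in $\mathbb R^d$. For $p>0$, $\mathcal M_p$ is the set of Borel probability measures on $\mathbb S^{d-1}$ minimizing $I_p(\mu)=\iint|x\cdot y|^p\,d\mu(x)\,d\mu(y)$ among all Borel probability measures on $\mathbb S^{d-1}$. $2\mathbb N$ is the set of positive even integers. *)

(* Defs.v *)
From HB Require Import structures.
From mathcomp Require Import all_boot all_order all_algebra.
From mathcomp Require Import all_classical all_reals all_analysis.

Set Implicit Arguments.
Unset Strict Implicit.
Unset Printing Implicit Defensive.

Import Order.TTheory GRing.Theory Num.Theory.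
Import numFieldNormedType.Exports.

Local Open Scope classical_set_scope.
Local Open Scope ring_scope.

(* The norm of 'rV[R]_n in the library is the sup norm, so the Euclidean
   structure is given by the dot product; both norms induce the same topology,
   hence the same Borel sets. *)
Definition dot (R : realType) (n : nat) (x y : 'rV[R]_n) : R :=
  \sum_(i < n) x 0 i * y 0 i.

(* S^n inside R^{n+1}; measurable types have to be pointed, which excludes the
   empty sphere of R^0. *)
Definition unit_sphere (R : realType) (n : nat) : set 'rV[R]_n.+1 :=
  [set x | dot x x = 1].
Arguments unit_sphere : clear implicits.

Lemma unit_sphere_delta (R : realType) (n : nat) :
  (delta_mx 0 0 : 'rV[R]_n.+1) \in unit_sphere R n.
Proof.
rewrite inE /unit_sphere /= /dot (bigD1 ord0) //= big1 => [|i /negbTE i0].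
  by rewrite !mxE !eqxx mulr1 addr0.
by rewrite !mxE i0 andbF mulr0.
Qed.

Definition sphere (R : realType) (n : nat) : Type := set_type (unit_sphere R n).

HB.instance Definition _ (R : realType) (n : nat) :=
  SubType.copy (sphere R n) (set_type (unit_sphere R n)).
HB.instance Definition _ (R : realType) (n : nat) :=
  PseudoMetric.copy (sphere R n) (set_type (unit_sphere R n)).
HB.instance Definition _ (R : realType) (n : nat) :=
  isPointed.Build (sphere R n) (exist _ (delta_mx 0 0) (unit_sphere_delta R n)).

Definition borelType (T : ptopologicalType) := g_sigma_algebraType (@open T).

Notation borel_probability T R := (probability (borelType T) R).

Definition measure_support (R : realType) (T : ptopologicalType)
    (mu : borel_probability T R) : set T :=
  [set x | forall U : set T, open U -> U x -> (0 < mu U)%E].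

Section frame_energy.
Context (R : realType) (n : nat).

Definition p_frame_energy (p : R) (mu : borel_probability (sphere R n) R) :
    \bar R :=
  (\int[mu]_x \int[mu]_y (`|dot (\val x) (\val y)| `^ p)%:E)%E.

Definition p_frame_minimizers (p : R) :
    set (borel_probability (sphere R n) R) :=
  [set mu | forall nu, (p_frame_energy p mu <= p_frame_energy p nu)%E].

End frame_energy.

Definition positive_even (R : realType) : set R :=
  [set p | exists2 k : nat, (0 < k)%N & p = (2 * k)%:R].
Arguments positive_even : clear implicits.

(* The unit sphere of R^d is S^{d-1} = sphere R d.-1, for d > 0 only. *)
Definition finite_support_exponents (R : realType) (d : nat) : set R :=
  [set p | [/\ 0 < p, ~ positive_even R p &
    forall mu : borel_probability (sphere R d.-1) R,
      p_frame_minimizers p mu -> finite_set (measure_support mu)]].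

(* Main.v *)
(* The exponents a / 2^k with a odd and 2^k >= d are dense, so it suffices to
   show that for p = a / b with a, b coprime and b >= d > 0 no minimizer has
   infinite support.

   Shifting mass between small neighbourhoods of points of its support shows
   that a minimizer makes |x . y|^p a positive kernel on the support. If the
   support is infinite, it contains infinitely many points with pairwise
   positive inner products; rescaling them by their inner product with one of
   them gives vectors x_n in R^d and a positive kernel g on the indices with
   g^b = (x_m . x_n)^a and g = 1 at the base point. There g - 1 is still
   positive, so the null combinations of (x_m . x_n)^a are null for g, and
   g is a Gram kernel g = sum_k phi_k(x_m) phi_k(x_n) with polynomial phi_k.

   A nonprincipal ultrafilter on the indices gives a generic point xi of the
   x_n, over a formally real field K with a derivation D that kills the
   constants but not xi. Expanding along the flow of D turns the identity into
   g^b = f^a between power series over K, where f = sum_i exp(sD)(xi_i) xi_i,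
   so f = H^b and g = H^a for one series H. All large powers of H are of the
   form sum_l exp(sD)(al_l) al_l, and formal reality then controls the growth
   of derivatives along the powers of H: each exp(sD)(xi_i) is a combination of
   the derivatives of f of order < d, hence divisible by H^(b - d + 1) with a
   quotient of degree d - 1. As b >= d, this confines all powers of some
   nonconstant exp(sD)(xi_i) / f, or of 1 / f, to a finite-dimensional space. *)
Require Import Defs.
From HB Require Import structures.
From mathcomp Require Import all_boot all_order all_algebra.
From mathcomp Require Import boolp ring zify lra.
From mathcomp Require mpoly.
Set Implicit Arguments.
Unset Strict Implicit.
Unset Printing Implicit Defensive.
Import Order.TTheory GRing.Theory Num.Theory.
Local Open Scope ring_scope.

(** * Formal power series *)

Record pseries (R : Type) := Pseries {coefs :> nat -> R}.

Lemma pseriesP (R : Type) (f g : pseries R) : (forall n, f n = g n) -> f = g.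
Proof. by case: f g => f [g] /= fg; congr Pseries; apply/funext. Qed.

Section PseriesRing.
Variable R : comNzRingType.
Implicit Types f g h : pseries R.

HB.instance Definition _ := gen_eqMixin (pseries R).
HB.instance Definition _ := gen_choiceMixin (pseries R).

Definition ps_add f g : pseries R := Pseries (fun n => f n + g n).
Definition ps_opp f : pseries R := Pseries (fun n => - f n).
Definition ps_mul f g : pseries R := Pseries (fun n => \sum_(i < n.+1) f i * g (n - i)%N).
Definition psC (c : R) : pseries R := Pseries (fun n => if n == 0%N then c else 0).

Lemma ps_addA : associative ps_add.
Proof. by move=> f g h; apply/pseriesP => n; rewrite /= addrA. Qed.
Lemma ps_addC : commutative ps_add.
Proof. by move=> f g; apply/pseriesP => n; rewrite /= addrC. Qed.
Lemma ps_add0 : left_id (psC 0) ps_add.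
Proof. by move=> f; apply/pseriesP => n; rewrite /= if_same add0r. Qed.
Lemma ps_addN : left_inverse (psC 0) ps_opp ps_add.
Proof.
by move=> f; apply/pseriesP => n; rewrite /= if_same addNr.
Qed.

Definition ps_trunc m f : {poly R} := \poly_(i < m) f i.

(** The first [m] coefficients of a product depend only on truncations, so commutativity is
    inherited from polynomials; associativity is obtained in the same way. *)
Lemma ps_mul_trunc m f g n : (n < m)%N ->
  ps_mul f g n = (ps_trunc m f * ps_trunc m g)`_n.
Proof.
move=> nm; rewrite coefM; apply: eq_bigr => i _; rewrite !coef_poly.
have im : (i < m)%N by rewrite (leq_trans _ nm) // ltn_ord.
by rewrite im (leq_ltn_trans (leq_subr _ _) nm).
Qed.

Lemma ps_mulC : commutative ps_mul.
Proof.
by move=> f g; apply/pseriesP => n; rewrite !(@ps_mul_trunc n.+1) // mulrC.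
Qed.

Lemma ps_mulA : associative ps_mul.
Proof.
move=> f g h; apply/pseriesP => n.
have H (a b : pseries R) (p q : {poly R}) m :
    (forall i, (i <= m)%N -> a i = p`_i) -> (forall i, (i <= m)%N -> b i = q`_i) ->
    forall i, (i <= m)%N -> ps_mul a b i = (p * q)`_i.
  move=> ap bq i im; rewrite coefM; apply: eq_bigr => j _.
  have jm : (j <= m)%N by rewrite (leq_trans _ im) // -ltnS ltn_ord.
  by rewrite ap // bq // (leq_trans (leq_subr _ _) im).
have T (a : pseries R) i : (i <= n)%N -> a i = (ps_trunc n.+1 a)`_i.
  by move=> ni; rewrite coef_poly ltnS ni.
rewrite (H _ _ _ _ n (T f) (H _ _ _ _ n (T g) (T h))) //.
by rewrite (H _ _ _ _ n (H _ _ _ _ n (T f) (T g)) (T h)) // mulrA.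
Qed.

Lemma psC_mulE c f n : ps_mul (psC c) f n = c * f n.
Proof.
rewrite /= big_ord_recl subn0 big1 ?addr0 // => i _.
by rewrite /= /= mul0r.
Qed.

Lemma ps_mul1 : left_id (psC 1) ps_mul.
Proof. by move=> f; apply/pseriesP => n; rewrite psC_mulE mul1r. Qed.
Lemma ps_mulDl : left_distributive ps_mul ps_add.
Proof.
move=> f g h; apply/pseriesP => n; rewrite /= -big_split.
by apply: eq_bigr => i _; rewrite mulrDl.
Qed.
Lemma ps_1neq0 : psC 1 != psC 0.
Proof.
apply/eqP => /(congr1 (fun f : pseries R => f 0%N)) /eqP.
by rewrite /= oner_eq0.
Qed.

HB.instance Definition _ :=
  GRing.isZmodule.Build (pseries R) ps_addA ps_addC ps_add0 ps_addN.
HB.instance Definition _ :=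
  GRing.Zmodule_isComNzRing.Build (pseries R) ps_mulA ps_mulC ps_mul1 ps_mulDl
    ps_1neq0.

Lemma psD f g n : (f + g) n = f n + g n. Proof. by []. Qed.
Lemma psN f n : (- f) n = - f n. Proof. by []. Qed.
Lemma ps0 n : (0 : pseries R) n = 0.
Proof. by rewrite -[0]/(psC 0) /= if_same. Qed.
Lemma psM f g n : (f * g) n = \sum_(i < n.+1) f i * g (n - i)%N.
Proof. by []. Qed.
Lemma psM0 f g : (f * g) 0%N = f 0%N * g 0%N.
Proof. by rewrite psM big_ord1 subnn. Qed.
Lemma psCM c f n : (psC c * f) n = c * f n.
Proof. exact: psC_mulE. Qed.
Lemma ps_sum (I : Type) (r : seq I) (P : pred I) (F : I -> pseries R) n :
  (\sum_(i <- r | P i) F i) n = \sum_(i <- r | P i) F i n.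
Proof.
elim/big_rec2: _ => [|i y x _ <-]; first by rewrite ps0.
by rewrite psD.
Qed.

Lemma psC_is_additive : zmod_morphism psC.
Proof. by move=> x y; apply/pseriesP => -[|n] //=; rewrite subr0. Qed.
Lemma psC_is_multiplicative : monoid_morphism psC.
Proof. by split=> // x y; apply/pseriesP => -[|n]; rewrite psCM //= mulr0. Qed.
HB.instance Definition _ := GRing.isZmodMorphism.Build R (pseries R) psC psC_is_additive.
HB.instance Definition _ :=
  GRing.isMonoidMorphism.Build R (pseries R) psC psC_is_multiplicative.

Lemma ps_X_coef f n k : f 0%N = 0 -> (k < n)%N -> (f ^+ n) k = 0.
Proof.
move=> f0; elim: n k => // n IH k kn; rewrite exprS psM big_ord_recl f0 mul0r add0r.
apply: big1 => i _; rewrite IH ?mulr0 //=.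
by rewrite /bump /= add1n; case: k kn i => [|k] kn i; [case: i|lia].
Qed.

(** The series z = 1 - v f has no constant term, so v times the geometric series of z inverts f; the
    partial sum [S k.+1] already has the coefficient of order k of that series. *)
Lemma ps_inv (f : pseries R) v : f 0%N * v = 1 -> exists g, f * g = 1.
Proof.
move=> fv.
pose z : pseries R := 1 - psC v * f.
have z0 : z 0%N = 0.
  by rewrite psD psN psCM mulrC fv subrr.
pose S n := \sum_(i < n) z ^+ i.
have SS n k : (k < n)%N -> S n k = S k.+1 k.
  elim: n => // n IH; rewrite ltnS leq_eqVlt => /orP [/eqP -> //|kn].
  by rewrite /S big_ord_recr psD -/(S n) IH //= ps_X_coef // addr0.
pose g := Pseries (fun k => S k.+1 k).
exists (psC v * g); rewrite mulrCA mulrA (_ : psC v * f = 1 - z); last first.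
  by rewrite /z opprB addrC subrK.
apply/pseriesP => n.
have -> : ((1 - z) * g) n = ((1 - z) * S n.+1) n.
  rewrite !psM; apply: eq_bigr => i _; congr (_ * _).
  by rewrite /g [RHS]SS // ltnS leq_subr.
rewrite /S -[1 - z]opprB mulNr -subrX1 opprB.
by rewrite psD psN ps_X_coef // subr0.
Qed.
End PseriesRing.

Lemma ps_mul_coef (R : comNzRingType) (a b : pseries R) (p q : {poly R}) m :
  (forall i, (i <= m)%N -> a i = p`_i) -> (forall i, (i <= m)%N -> b i = q`_i) ->
  forall i, (i <= m)%N -> (a * b) i = (p * q)`_i.
Proof.
move=> ap bq i im; rewrite coefM psM; apply: eq_bigr => j _.
have jm : (j <= m)%N by rewrite (leq_trans _ im) // -ltnS ltn_ord.
by rewrite ap // bq // (leq_trans (leq_subr _ _) im).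
Qed.

Lemma ps_derivM (R : comNzRingType) (f g : pseries R) n :
  (f * g) n.+1 *+ n.+1 =
  (Pseries (fun k => f k.+1 *+ k.+1) * g
   + f * Pseries (fun k => g k.+1 *+ k.+1)) n.
Proof.
set f' := Pseries _; set g' := Pseries _.
pose tr (h : pseries R) := ps_trunc n.+2 h.
have trE (h : pseries R) i : (i <= n.+1)%N -> h i = (tr h)`_i by move=> ni; rewrite coef_poly ltnS ni.
have trE' (h : pseries R) i : (i <= n)%N -> h i = (tr h)`_i by move=> ni; rewrite trE // leqW.
have dE (h : pseries R) i : (i <= n)%N ->
    Pseries (fun k => h k.+1 *+ k.+1) i = (tr h)^`()`_i.
  by move=> ni; rewrite coef_deriv -trE.
rewrite psD (ps_mul_coef (trE f) (trE g)) //.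
rewrite (ps_mul_coef (dE f) (trE' g)) // (ps_mul_coef (trE' f) (dE g)) //.
by rewrite -coef_deriv derivM coefD.
Qed.

(** * Taylor expansions along a derivation of a formally real field *)

Section TaylorSeries.
Variables (K : fieldType) (D : K -> K).
Hypothesis DD : {morph D : x y / x + y}.
Hypothesis DM : forall x y, D (x * y) = D x * y + x * D y.
Hypothesis realK : forall (T : finType) (z : T -> K),
  \sum_t z t ^+ 2 = 0 -> forall t, z t = 0.

(** Formal reality, applied to a sum of n + 1 ones, forces characteristic zero. *)
Lemma real_natr_neq0 n : n.+1%:R != 0 :> K.
Proof.
apply/eqP => n0; have := @realK 'I_n.+1 (fun=> 1).
rewrite (eq_bigr (fun=> 1)) => [|i _]; last by rewrite expr1n.
by rewrite sumr_const card_ord => /(_ n0 ord0) /eqP; rewrite oner_eq0.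
Qed.

Lemma real_fact_neq0 n : n`!%:R != 0 :> K.
Proof. by case: (n`!) (fact_gt0 n) => // m _; apply: real_natr_neq0. Qed.

Lemma D0 : D 0 = 0.
Proof. by apply: (@addrI _ (D 0)); rewrite -DD !addr0. Qed.
Lemma DN x : D (- x) = - D x.
Proof. by apply: (@addrI _ (D x)); rewrite -DD !subrr D0. Qed.
Lemma DB x y : D (x - y) = D x - D y.
Proof. by rewrite DD DN. Qed.
Lemma D1 : D 1 = 0.
Proof. by have := DM 1 1; rewrite !mulr1 mul1r => h; apply: (@addrI _ (D 1)); rewrite addr0 -h. Qed.
Lemma Dsum (I : Type) (r : seq I) (P : pred I) (F : I -> K) :
  D (\sum_(i <- r | P i) F i) = \sum_(i <- r | P i) D (F i).
Proof. by elim/big_rec2: _ => [|i x y _ <-]; rewrite ?D0 ?DD. Qed.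
Lemma Dn x n : D (x *+ n) = D x *+ n.
Proof. by elim: n => [|n IH]; rewrite ?mulr0n ?D0 // !mulrS DD IH. Qed.
Lemma D_natr n : D n%:R = 0. Proof. by rewrite Dn D1 mul0rn. Qed.

Lemma Dconst_mul x y : D x = 0 -> D (x * y) = x * D y.
Proof. by move=> x0; rewrite DM x0 mul0r add0r. Qed.

Lemma D_div_natr x n : D (x / n.+1%:R) = D x / n.+1%:R.
Proof.
apply: (mulfI (real_natr_neq0 n)); rewrite -Dconst_mul ?D_natr //.
by rewrite mulrC divfK ?real_natr_neq0 // mulrC divfK ?real_natr_neq0.
Qed.

Lemma D_div_fact x n : D (x / n`!%:R) = D x / n`!%:R.
Proof. by case: (n`!) (fact_gt0 n) => // m _; exact: D_div_natr. Qed.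

Lemma iterD_D k x y : iter k D (x + y) = iter k D x + iter k D y.
Proof. by elim: k => //= k ->; rewrite DD. Qed.
Lemma iterD_0 k : iter k D 0 = 0.
Proof. by elim: k => //= k ->; rewrite D0. Qed.

(* The Taylor expansion along the flow of D, that is exp (s D) z. *)
Definition taylor (z : K) : pseries K := Pseries (fun k => iter k D z / k`!%:R).
Definition ps_shift (E : pseries K) : pseries K :=
  Pseries (fun k => E k.+1 *+ k.+1).
(* [psd] differentiates coefficients and subtracts d/ds: this derivation kills
   Taylor expansions and agrees with D on constants. *)
Definition psd (E : pseries K) : pseries K :=
  Pseries (fun k => D (E k) - ps_shift E k).

Lemma taylor_shift z : ps_shift (taylor z) = taylor (D z).
Proof.
apply/pseriesP => k /=; rewrite -iterS iterSr factS mulnC natrM -[LHS]mulr_natr.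
by rewrite invfM mulrA divfK // real_natr_neq0.
Qed.

Lemma taylorD x y : taylor (x + y) = taylor x + taylor y.
Proof. by apply/pseriesP => k; rewrite psD /= iterD_D mulrDl. Qed.

(** Differentiation in s sends [taylor z] to [taylor (D z)], so the Leibniz rules for series and for
    [D] give the coefficient of order n + 1 from those of order n. *)
Lemma taylorM x y : taylor (x * y) = taylor x * taylor y.
Proof.
apply/pseriesP => n; elim: n x y => [|n IH] x y; first by rewrite psM0 /= !fact0 !divr1.
apply: (mulIf (real_natr_neq0 n)); rewrite !mulr_natr ps_derivM.
have sh z : Pseries (fun k => taylor z k.+1 *+ k.+1) = taylor (D z).
  exact: taylor_shift.
have -> : taylor (x * y) n.+1 *+ n.+1 = taylor (D (x * y)) n.
  by rewrite -taylor_shift.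
by rewrite !sh DM taylorD !psD !IH.
Qed.

Lemma taylor_const c : D c = 0 -> taylor c = psC c.
Proof.
move=> Dc; apply/pseriesP => -[|k] /=; first by rewrite fact0 divr1.
by rewrite -iterS iterSr Dc iterD_0 mul0r.
Qed.

Lemma taylor1 : taylor 1 = 1. Proof. by rewrite taylor_const ?D1. Qed.
Lemma taylor0 : taylor 0 = 0. Proof. by rewrite taylor_const ?D0 ?rmorph0. Qed.

Lemma taylor_sum (I : Type) (r : seq I) (P : pred I) (F : I -> K) :
  taylor (\sum_(i <- r | P i) F i) = \sum_(i <- r | P i) taylor (F i).
Proof. by elim/big_rec2: _ => [|i x y _ <-]; rewrite ?taylor0 ?taylorD. Qed.
Lemma taylor_prod (I : Type) (r : seq I) (P : pred I) (F : I -> K) :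
  taylor (\prod_(i <- r | P i) F i) = \prod_(i <- r | P i) taylor (F i).
Proof. by elim/big_rec2: _ => [|i x y _ <-]; rewrite ?taylor1 ?taylorM. Qed.

Lemma psdD E F : psd (E + F) = psd E + psd F.
Proof.
apply/pseriesP => k; rewrite [RHS]psD /= DD mulrnDl; ring.
Qed.
Lemma psd0 : psd 0 = 0.
Proof. by apply: (@addrI _ (psd 0)); rewrite -psdD !addr0. Qed.
Lemma psdM E F : psd (E * F) = psd E * F + E * psd F.
Proof.
have psdE G : psd G = Pseries (fun k => D (G k)) - ps_shift G by apply/pseriesP.
have shM : ps_shift (E * F) = ps_shift E * F + E * ps_shift F.
  by apply/pseriesP => k; rewrite -ps_derivM.
have DcM : Pseries (fun k => D ((E * F) k)) =
    Pseries (fun k => D (E k)) * F + E * Pseries (fun k => D (F k)).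
  apply/pseriesP => k; rewrite psD !psM /= Dsum -big_split.
  by apply: eq_bigr => i _; exact: DM.
by rewrite !psdE shM DcM; ring.
Qed.
Lemma psd_sum (I : Type) (r : seq I) (P : pred I) (F : I -> pseries K) :
  psd (\sum_(i <- r | P i) F i) = \sum_(i <- r | P i) psd (F i).
Proof. by elim/big_rec2: _ => [|i x y _ <-]; rewrite ?psd0 ?psdD. Qed.
Lemma psd_taylor z : psd (taylor z) = 0.
Proof.
apply/pseriesP => k; rewrite ps0 /psd taylor_shift /= D_div_fact.
by rewrite -iterS iterSr subrr.
Qed.
Lemma psdC c : psd (psC c) = psC (D c).
Proof. by apply/pseriesP => -[|k] /=; rewrite mul0rn subr0 ?D0. Qed.

Lemma iter_psd_D k E F : iter k psd (E + F) = iter k psd E + iter k psd F.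
Proof. by elim: k => //= k ->; rewrite psdD. Qed.
Lemma iter_psd_sum (T : finType) (F : T -> pseries K) k :
  iter k psd (\sum_t F t) = \sum_t iter k psd (F t).
Proof. by elim: k => //= k ->; rewrite psd_sum. Qed.
Lemma iter_psd_taylorC k z c :
  iter k psd (taylor z * psC c) = taylor z * psC (iter k D c).
Proof.
by elim: k => //= k ->; rewrite psdM psd_taylor psdC mul0r add0r.
Qed.

(** * Linear functionals on power series *)

Definition ps_apply n (c : nat -> K) (E : pseries K) : K := \sum_(k < n) c k * E k.
(** The linear functionals that read finitely many coefficients; spans of series are tested against
    them. *)
Definition coef_functional (l : pseries K -> K) : Prop :=
  exists n c, forall E, l E = ps_apply n c E.

Section FunctionalTheory.
Variable l : pseries K -> K.
Hypothesis lP : coef_functional l.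

Lemma functD E F : l (E + F) = l E + l F.
Proof.
have [n [c lE]] := lP; rewrite !lE /ps_apply -big_split.
by apply: eq_bigr => k _; rewrite psD mulrDr.
Qed.
Lemma functZ a E : l (psC a * E) = a * l E.
Proof.
have [n [c lE]] := lP; rewrite !lE /ps_apply mulr_sumr.
by apply: eq_bigr => k _; rewrite psCM mulrCA.
Qed.
Lemma funct0 : l 0 = 0.
Proof. by rewrite -[0](mul0r 0) -{1}(rmorph0 (@psC K)) functZ mul0r. Qed.
Lemma functN E : l (- E) = - l E.
Proof. by apply: (@addrI _ (l E)); rewrite -functD !subrr funct0. Qed.
Lemma funct_sum (I : Type) (r : seq I) (P : pred I) (F : I -> pseries K) :
  l (\sum_(i <- r | P i) F i) = \sum_(i <- r | P i) l (F i).
Proof. by elim/big_rec2: _ => [|i x y _ <-]; rewrite ?funct0 ?functD. Qed.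

Lemma functM E : coef_functional (fun F => l (E * F)).
Proof.
have [n [c lE]] := lP.
exists n, (fun j => \sum_(k < n | (j <= k)%N) c k * E (k - j)%N) => F.
rewrite lE /ps_apply.
transitivity (\sum_(k < n) \sum_(j < n | (j <= k)%N) c k * E (k - j)%N * F j).
  apply: eq_bigr => k _; rewrite mulrC [E * F]mulrC psM mulr_suml.
  rewrite (big_ord_widen_cond n xpredT (fun j => F j * E (k - j)%N * c k)) //.
  by apply: eq_big => [j|j _]; rewrite ?ltnS //; ring.
rewrite (exchange_big_dep xpredT) //=.
by apply: eq_bigr => j _; rewrite mulr_suml.
Qed.
End FunctionalTheory.

Lemma coef_functional_coef k : coef_functional (fun E => E k).
Proof.
exists k.+1, (fun j => (j == k)%:R) => E.
rewrite /ps_apply big_ord_recr /= eqxx mul1r big1 ?add0r // => i _.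
by rewrite (ltn_eqF (ltn_ord i)) mul0r.
Qed.

Lemma coef_functional_add l m : coef_functional l -> coef_functional m ->
  coef_functional (fun E => l E + m E).
Proof.
move=> [n [c lE]] [p [e mE]].
exists (maxn n p), (fun k => (if (k < n)%N then c k else 0) + (if (k < p)%N then e k else 0)).
move=> E; rewrite lE mE /ps_apply.
rewrite (big_ord_widen (maxn n p) (fun k => c k * E k)) ?leq_maxl //.
rewrite (big_ord_widen (maxn n p) (fun k => e k * E k)) ?leq_maxr //.
rewrite big_mkcond [X in _ + X]big_mkcond -big_split; apply: eq_bigr => k _ /=.
by rewrite mulrDl; do 2![case: ifP => _; rewrite ?mul0r].
Qed.

Lemma coef_functional_scale a l : coef_functional l ->
  coef_functional (fun E => a * l E).
Proof.
move=> [n [c lE]]; exists n, (fun k => a * c k) => E.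
by rewrite lE /ps_apply mulr_sumr; apply: eq_bigr => k _; rewrite mulrA.
Qed.

Lemma coef_functional_sum (I : Type) (r : seq I) (F : I -> pseries K -> K) :
  (forall i, coef_functional (F i)) ->
  coef_functional (fun E => \sum_(i <- r) F i E).
Proof.
move=> FP; elim: r => [|i r [n [c IH]]].
  by exists 0%N, (fun=> 0) => E; rewrite big_nil /ps_apply big_ord0.
have [m [e H]] := coef_functional_add (FP i)
  (ex_intro _ n (ex_intro _ c IH) : coef_functional _).
by exists m, e => E; rewrite big_cons H.
Qed.

(** Replacing E by [psC a * E], both terms acquire the same extra summand [D a * l E], so the
    difference is linear over [K]. Up to sign it is the transpose of [psd]. *)
Lemma functional_psd l : coef_functional l ->
  coef_functional (fun E => D (l E) - l (psd E)).
Proof.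
move=> [n [c lE]].
suff [m [e H]] : coef_functional (fun E => \sum_(k < n) (D (c k) * E k + c k *+ k.+1 * E k.+1)).
  exists m, e => E; rewrite -H !lE /ps_apply Dsum -sumrB; apply: eq_bigr => k _.
  by rewrite /= DM mulrnAl -mulrnAr; ring.
have [m [e H]] := coef_functional_sum (index_enum 'I_n)
  (fun k : 'I_n => coef_functional_add
     (coef_functional_scale (D (c k)) (coef_functional_coef k))
     (coef_functional_scale (c k *+ k.+1) (coef_functional_coef k.+1))).
by exists m, e => E; rewrite H.
Qed.

Lemma ps_mul_order (f g : pseries K) p q :
  (forall n, (n < p)%N -> f n = 0) -> (forall n, (n < q)%N -> g n = 0) ->
  (forall n, (n < p + q)%N -> (f * g) n = 0) /\ (f * g) (p + q)%N = f p * g q.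
Proof.
move=> fp gq; split=> [n npq|].
  rewrite psM big1 // => i _; case: (ltnP i p) => [ip|pi]; first by rewrite fp ?mul0r.
  by rewrite gq ?mulr0 //; have := ltn_ord i; lia.
have pp : (p < (p + q).+1)%N by lia.
rewrite psM (bigD1 (Ordinal pp)) //= big1 ?addr0 => [|i]; first by rewrite addKn.
rewrite -val_eqE /= => ip; case: (ltnP i p) => [lip|pi]; first by rewrite fp ?mul0r.
by rewrite gq ?mulr0 //; have := ltn_ord i; lia.
Qed.

(** If w has order [om] > 0, then w^j has order j om. A nonzero combination v of the coefficients of
    orders i om, for i <= #|T|, kills every [e t]. At the largest j with v_j nonzero it maps w^j to
    v_j times the leading coefficient. *)
Lemma powers_infinite_dim (T : finType) (e : T -> pseries K) (w : pseries K) :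
  w 0%N = 0 -> (exists n, w n != 0) ->
  exists l, [/\ coef_functional l, forall t, l (e t) = 0 & exists j, l (w ^+ j) != 0].
Proof.
move=> w0 wn; pose om := ex_minn wn.
have [wom omin] : w om != 0 /\ forall n, (n < om)%N -> w n = 0.
  rewrite /om; case: ex_minnP => m wm mmin; split=> // n nm.
  by apply/eqP; apply: contraTT nm => /mmin; rewrite leqNgt.
have om_gt0 : (0 < om)%N by case: (om) wom => //; rewrite w0 eqxx.
have wj j : (forall n, (n < j * om)%N -> (w ^+ j) n = 0) /\ (w ^+ j) (j * om)%N = w om ^+ j.
  elim: j => [|j [IH1 IH2]]; first by rewrite mul0n !expr0.
  rewrite mulSn !exprS; have [H1 H2] := ps_mul_order omin IH1.
  by split=> //; rewrite H2 IH2.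
pose m := #|T|.
pose A := \matrix_(i < m.+1, j < m) e (enum_val j) (i * om)%N.
have /rowV0Pn [v /sub_kermxP vA v0] : kermx A != 0.
  rewrite kermx_eq0 /row_free neq_ltn; apply/orP; left.
  by rewrite ltnS rank_leq_col.
exists (fun E => \sum_(i < m.+1) v 0 i * E (i * om)%N); split.
- exact: (coef_functional_sum (index_enum 'I_m.+1)
    (fun i : 'I_m.+1 => coef_functional_scale (v 0 i) (coef_functional_coef (i * om)%N))).
- move=> t; have := congr1 (fun B : 'M_(1, m) => B 0 (enum_rank t)) vA.
  rewrite !mxE => {2}<-; apply: eq_bigr => i _; rewrite !mxE enum_rankK.
  by [].
- have /existsP [i0 vi0] : [exists i, v 0 i != 0].
    apply: contraR v0; rewrite negb_exists => /forallP v0.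
    by apply/eqP/rowP => i; rewrite mxE; apply/eqP; rewrite -[_ == _]negbK v0.
  case: (@arg_maxnP _ i0 (fun i => v 0 i != 0) (fun i : 'I_m.+1 => nat_of_ord i) vi0) => j vj jmax.
  exists j; rewrite (bigD1 j) //= big1 => [|i ij].
    by rewrite addr0 (wj j).2 mulf_neq0 // expf_neq0.
  have [->|vi] := eqVneq (v 0 i) 0; first by rewrite mul0r.
  rewrite (wj j).1 ?mulr0 // ltn_pmul2r // ltn_neqAle ij; exact: jmax.
Qed.

(** * Growth measured along the powers of a series *)

Section PowerFiltration.
Variable H : pseries K.

Definition annihilates N (l : pseries K -> K) : Prop :=
  coef_functional l /\ forall k, l (iter k psd (H ^+ N)) = 0.
(* Membership in the span of the [psd]-iterates of H^N, expressed by duality. *)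
Definition in_span N (E : pseries K) : Prop := forall l, annihilates N l -> l E = 0.
(** For such N the span of the [psd]-iterates of H^N is that of the finitely many [taylor (al t)]:
    the two have the same annihilators. *)
Definition decomposable N : Prop :=
  exists (T : finType) (al : T -> K), H ^+ N = \sum_t taylor (al t) * psC (al t).

Lemma decomposableD N M : decomposable N -> decomposable M -> decomposable (N + M).
Proof.
move=> [T [al Hal]] [S [be Hbe]].
exists (T * S)%type, (fun p => al p.1 * be p.2).
rewrite exprD Hal Hbe big_distrlr pair_bigA /=; apply: eq_bigr => -[t s] _ /=.
by rewrite taylorM rmorphM /=; ring.
Qed.

Lemma decomposable0 : decomposable 0.
Proof.
exists unit, (fun=> 1); rewrite expr0 (big_pred1 tt) => [|[]//].
by rewrite taylor1 rmorph1 mulr1.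
Qed.

Lemma decomposableM N k : decomposable N -> decomposable (k * N).
Proof.
move=> dN; elim: k => [|k IH]; first exact: decomposable0.
by rewrite mulSn; apply: decomposableD.
Qed.

Section Decomposed.
Variables (N : nat) (T : finType) (al : T -> K).
Hypothesis Hal : H ^+ N = \sum_t taylor (al t) * psC (al t).

(* If l has coefficients c, applying c to the Taylor side and to the constant
   side of the decomposition gives the sum of the squares of l (taylor (al t)). *)
Lemma annihilates_taylor l t : annihilates N l -> l (taylor (al t)) = 0.
Proof.
move=> [lP l0]; move: t; apply: realK.
have [n [c lE]] := lP.
have l0' k : \sum_t iter k D (al t) * l (taylor (al t)) = 0.
  rewrite -[RHS](l0 k) Hal iter_psd_sum (funct_sum lP); apply: eq_bigr => t _.
  by rewrite iter_psd_taylorC [taylor _ * _]mulrC (functZ lP).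
transitivity (\sum_(k < n) c k / k`!%:R * \sum_t iter k D (al t) * l (taylor (al t))).
  rewrite (eq_bigr (fun t => \sum_(k < n) c k / k`!%:R * (iter k D (al t) * l (taylor (al t))))).
    by rewrite exchange_big; apply: eq_bigr => k _; rewrite mulr_sumr.
  move=> t _; rewrite expr2 {1}lE /ps_apply mulr_suml; apply: eq_bigr => k _ /=.
  by ring.
by rewrite big1 // => k _; rewrite l0' mulr0.
Qed.

(** Iterates of [psd] act only on the constant factors [psC (al t)], because [psd] kills
    [taylor (al t)]. *)
Lemma taylor_annihilates l : coef_functional l ->
  (forall t, l (taylor (al t)) = 0) -> annihilates N l.
Proof.
move=> lP l0; split=> // k; rewrite Hal iter_psd_sum (funct_sum lP) big1 // => t _.
by rewrite iter_psd_taylorC mulrC (functZ lP) l0 mulr0.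
Qed.
End Decomposed.

Lemma in_spanD N E F : in_span N E -> in_span N F -> in_span N (E + F).
Proof. by move=> EZ FZ l ln; rewrite (functD ln.1) EZ // FZ // addr0. Qed.
Lemma in_spanZ N a E : in_span N E -> in_span N (psC a * E).
Proof. by move=> EZ l ln; rewrite (functZ ln.1) EZ // mulr0. Qed.
Lemma in_span0 N : in_span N 0.
Proof. by move=> l ln; rewrite (funct0 ln.1). Qed.
Lemma in_spanB N E F : in_span N E -> in_span N F -> in_span N (E - F).
Proof. by move=> EZ FZ l ln; rewrite (functD ln.1) (functN ln.1) EZ // FZ // subr0. Qed.
Lemma in_spanMn N E n : in_span N E -> in_span N (E *+ n).
Proof.
by move=> EZ; elim: n => [|n IH]; rewrite ?mulr0n ?mulrS; [exact: in_span0|exact: in_spanD].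
Qed.
Lemma in_span_sum N (I : Type) (r : seq I) (P : pred I) (F : I -> pseries K) :
  (forall i, P i -> in_span N (F i)) -> in_span N (\sum_(i <- r | P i) F i).
Proof. by move=> FZ; elim/big_ind: _ => //; [exact: in_span0|exact: in_spanD]. Qed.

Lemma in_span_self N : in_span N (H ^+ N).
Proof. by move=> l [lP /(_ 0%N)]. Qed.

(** The transpose of [psd] preserves the annihilator of the iterates, so E can be tested against the
    transposed functional. *)
Lemma in_span_psd N E : in_span N E -> in_span N (psd E).
Proof.
move=> EZ l [lP l0].
have : annihilates N (fun F => D (l F) - l (psd F)).
  split; first exact: functional_psd.
  by move=> k; rewrite l0 -[psd _]/(iter k.+1 psd _) l0 D0 subrr.
by move/EZ; rewrite EZ // D0 sub0r => /eqP; rewrite oppr_eq0 => /eqP.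
Qed.

Lemma in_span_iter_psd N k E : in_span N E -> in_span N (iter k psd E).
Proof. by move=> EZ; elim: k => //= k; exact: in_span_psd. Qed.

(** The products al_t be_s decompose H^(N + M), so l kills all [taylor (al t) * taylor (be s)]. By
    duality E may replace one factor, and then F the other. *)
Lemma in_spanM N M E F : decomposable N -> decomposable M ->
  in_span N E -> in_span M F -> in_span (N + M) (E * F).
Proof.
move=> [T [al Hal]] [S [be Hbe]] EZ FZ l ln.
have Hab : H ^+ (N + M) = \sum_p taylor (al p.1 * be p.2) * psC (al p.1 * be p.2).
  rewrite exprD Hal Hbe big_distrlr pair_bigA /=; apply: eq_bigr => -[t s] _ /=.
  by rewrite taylorM rmorphM /=; ring.
have lab t s : l (taylor (be s) * taylor (al t)) = 0.
  by rewrite mulrC -taylorM (annihilates_taylor Hab (t, s) ln).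
apply: (FZ (fun G => l (E * G))); apply: (taylor_annihilates Hbe).
  exact: (functM ln.1).
move=> s; rewrite mulrC; apply: (EZ (fun G => l (taylor (be s) * G))).
by apply: (taylor_annihilates Hal) => //; exact: (functM ln.1).
Qed.

Lemma in_span_natr N E n : in_span N (E *+ n.+1) -> in_span N E.
Proof.
move=> /(in_spanZ (n.+1%:R)^-1); congr in_span.
have -> : E *+ n.+1 = psC n.+1%:R * E by rewrite rmorph_nat mulr_natl.
by rewrite mulrA -rmorphM /= mulVf ?real_natr_neq0 // rmorph1 mul1r.
Qed.
Lemma in_span_fact N E n : in_span N (E *+ n`!) -> in_span N E.
Proof. by case: (n`!) (fact_gt0 n) => // m _; exact: in_span_natr. Qed.

(* [ad E n m] is the n-fold commutator of the operator [psd^m] with the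
   multiplication by E; for n = m it is m! times the multiplication by
   [(psd E)^m]. *)
Fixpoint ad (E : pseries K) n m G : pseries K :=
  if n is n'.+1 then ad E n' m (E * G) - E * ad E n' m G else iter m psd G.

Lemma adD E n m F G : ad E n m (F + G) = ad E n m F + ad E n m G.
Proof.
elim: n F G => [|n IH] F G /=; first exact: iter_psd_D.
by rewrite mulrDr !IH; ring.
Qed.

(** Leibniz rule for iterated commutators: the commutator of [psd] with E is multiplication by
    [psd E], which commutes with E, so only two terms survive. *)
Lemma adS E n m G :
  ad E n m.+1 G = ad E n m (psd G) + ad E n.-1 m (psd E * G) *+ n.
Proof.
elim: n G => [|n IH] G; first by rewrite mulr0n addr0 /= -iterS iterSr.
rewrite [LHS]/= !IH psdM !adD [ad E n.+1 m (psd G)]/=; case: n IH => [|n] _ /=.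
  by rewrite !mulr0n; ring.
rewrite (_ : psd E * (E * G) = E * (psd E * G)); last by ring.
rewrite [in RHS]mulrSr mulrnBl mulrDr -!mulrnAr.
by move: (_ *+ n.+1) (_ *+ n.+1) => u v; ring.
Qed.

(** The operator psd^m is a differential operator of order m, so more than m commutators with
    multiplications annihilate it. *)
Lemma ad_gt E n m G : (m < n)%N -> ad E n m G = 0.
Proof.
elim: m n G => [|m IH] n G mn.
  elim: n G mn => // -[|n] IH G _; first by rewrite /= subrr.
  by rewrite -[LHS]/(ad E n.+1 0 (E * G) - E * ad E n.+1 0 G) !IH // mulr0 subr0.
rewrite adS IH 1?ltnW // add0r IH ?mul0rn //; case: n mn => //.
Qed.

Lemma ad_diag E m G : ad E m m G = psd E ^+ m * G *+ m`!.
Proof.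
elim: m G => [|m IH] G; first by rewrite /= mul1r mulr1n.
rewrite adS ad_gt // add0r /= IH -mulrnA factS mulnC; congr (_ *+ _).
by rewrite exprS mulrA [psd E * _]mulrC.
Qed.

Variable N0 : nat.
Hypothesis decN0 : forall N, (N0 <= N)%N -> decomposable N.

Let decD x c : (N0 <= c)%N -> decomposable (x + c).
Proof. by move=> c0; apply: decN0; apply: leq_trans c0 (leq_addl _ _). Qed.

(* [degree_le E e]: the powers of E grow at most like those of H^e. *)
Definition degree_le E e : Prop := exists2 c, (N0 <= c)%N &
  forall m, in_span (e * m + c) (E ^+ m * H ^+ c).

Lemma degree_leM E F e g : degree_le E e -> degree_le F g -> degree_le (E * F) (e + g).
Proof.
move=> [c c0 Ec] [c' c'0 Fc]; exists (c + c')%N; first by lia.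
move=> m; rewrite exprMn exprD mulrACA.
have -> : ((e + g) * m + (c + c') = (e * m + c) + (g * m + c'))%N by lia.
by apply: in_spanM => //; apply: decD.
Qed.

Lemma degree_leD E F e : degree_le E e -> degree_le F e -> degree_le (E + F) e.
Proof.
move=> [c c0 Ec] [c' c'0 Fc]; exists (c + c')%N; first by lia.
move=> m; rewrite exprDn mulr_suml; apply: in_span_sum => i _.
rewrite mulrnAl; apply: in_spanMn.
have im : (i <= m)%N by rewrite -ltnS ltn_ord.
rewrite exprD mulrACA.
have -> : (e * m + (c + c') = (e * (m - i) + c) + (e * i + c'))%N.
  by rewrite -[in LHS](subnK im); lia.
by apply: in_spanM => //; apply: decD.
Qed.

Lemma degree_leC a : degree_le (psC a) 0.
Proof.
exists N0 => // m; rewrite mul0n add0n -rmorphXn; apply: in_spanZ.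
exact: in_span_self.
Qed.

Lemma degree_le_self : degree_le H 1.
Proof. by exists N0 => // m; rewrite mul1n -exprD; apply: in_span_self. Qed.

Lemma degree_leX E e n : degree_le E e -> degree_le (E ^+ n) (n * e).
Proof.
move=> Ee; elim: n => [|n IH].
  by rewrite expr0 mul0n -(rmorph1 (@psC K)); apply: degree_leC.
by rewrite exprS mulSn; apply: degree_leM.
Qed.

Lemma degree_le_sum (I : Type) (r : seq I) (F : I -> pseries K) e :
  (forall i, degree_le (F i) e) -> degree_le (\sum_(i <- r) F i) e.
Proof.
move=> FE; elim/big_rec: _ => [|i E _ IH]; last exact: degree_leD (FE i) IH.
exists N0 => // m; case: m => [|m]; last by rewrite exprS !mul0r; apply: in_span0.
by rewrite expr0 mul1r muln0 add0n; apply: in_span_self.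
Qed.

(** By [ad_diag], m! (psd E)^m is an m-fold commutator. Its expansion puts each copy of E inside or
    outside psd^m, and [psd] does not leave the span of a given power of H. *)
Lemma degree_le_psd E e : degree_le E e -> degree_le (psd E) e.
Proof.
move=> [c c0 Ec]; exists (c + c)%N; first by lia.
move=> m; apply: (@in_span_fact _ _ m).
rewrite exprD mulrA -mulrnAl -ad_diag.
(* Here i copies of E stand inside psd^m, j outside, and n are still to be distributed. *)
have HadE n i j : in_span (e * (n + i + j) + (c + c))
    (ad E n m (E ^+ i * H ^+ c) * (E ^+ j * H ^+ c)).
  elim: n i j => [|n IH] i j.
    have -> : (e * (0 + i + j) + (c + c) = (e * i + c) + (e * j + c))%N by lia.
    by apply: in_spanM => //; [exact: decD|exact: decD|exact: in_span_iter_psd].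
  rewrite /= mulrBl; apply: in_spanB.
    by rewrite mulrA -exprS addSnnS; apply: IH.
  have -> : (n.+1 + i + j = n + i + j.+1)%N by lia.
  by rewrite [E * _]mulrC -mulrA [E * (_ * _)]mulrA -exprS; apply: IH.
by have := HadE m 0%N 0%N; rewrite !addn0 !mul1r.
Qed.

(** Each application of [psd] costs one factor H and raises the degree of the cofactor by one. *)
Lemma iter_psd_pow b j : (j <= b)%N ->
  exists2 P, degree_le P j & iter j psd (H ^+ b) = H ^+ (b - j) * P.
Proof.
elim: j => [|j IH] jb.
  exists 1; last by rewrite subn0 mulr1.
  by rewrite -(rmorph1 (@psC K)); apply: degree_leC.
rewrite iterS; have [P Pj ->] := IH (ltnW jb).
have psdX n : psd (H ^+ n.+1) = H ^+ n * psd H *+ n.+1.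
  elim: n => [|n IHn]; first by rewrite expr1 expr0 mul1r.
  rewrite exprS psdM IHn mulrSr exprS; ring.
exists (psd H * P *+ (b - j.+1).+1 + H * psd P).
  apply: degree_leD; last by rewrite -[j.+1]add1n; apply: degree_leM;
    [exact: degree_le_self|exact: degree_le_psd].
  rewrite -mulr_natl -(rmorph_nat (@psC K)) -[j.+1]add0n; apply: degree_leM.
    exact: degree_leC.
  by rewrite -add1n; exact: degree_leM (degree_le_psd degree_le_self) Pj.
rewrite psdM -(subnSK jb) psdX exprS; ring.
Qed.

(** The additive constant [c i] is paid once for each index i, whatever the exponent [al i]. *)
Lemma degree_le_prod (I : Type) (r : seq I) (F : I -> pseries K) e (al : I -> nat) (c : I -> nat) :
  (forall i, N0 <= c i)%N ->
  (forall i m, in_span (e * m + c i) (F i ^+ m * H ^+ c i)) ->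
  in_span (e * (\sum_(i <- r) al i) + \sum_(i <- r) c i)
    (\prod_(i <- r) F i ^+ al i * H ^+ (\sum_(i <- r) c i)).
Proof.
move=> c0 Fc; elim: r => [|i r IH].
  by rewrite !big_nil muln0 mulr1; apply: in_span_self.
rewrite !big_cons exprD mulrACA.
have -> a b x y : (e * (a + b) + (x + y) = (e * a + x) + (e * b + y))%N by lia.
apply: in_spanM => //; first exact: decD.
case: r {IH} => [|j r]; first by rewrite !big_nil muln0; apply: decomposable0.
rewrite [X in (_ + X)%N]big_cons; apply: decD.
exact: leq_trans (c0 j) (leq_addr _ _).
Qed.
End PowerFiltration.

(** * Expansions as combinations of finitely many derivatives *)

Section DerivativeSpan.
Variables (d : nat) (xi : 'I_d -> K).
Let jet k : 'rV[K]_d := \row_i iter k D (xi i).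
Let jets m : 'M[K]_(m, d) := \matrix_(k < m) jet k.

Let jets_sub m n : (m <= n)%N -> (jets m <= jets n)%MS.
Proof.
move=> mn; apply/row_subP => k; rewrite rowK.
by have := row_sub (widen_ord mn k) (jets n); rewrite rowK.
Qed.

(** Wronskian argument: d + 1 vectors of K^d are dependent, so some jet of order m <= d lies in the
    span of the earlier ones, and differentiating this relation keeps all later jets there. *)
Let jet_sub k : (jet k <= jets d)%MS.
Proof.
have [m md mP] : exists2 m, (m <= d)%N & (jet m <= jets m)%MS.
  apply: contrapT => noex.
  have rk m : (m <= d.+1)%N -> \rank (jets m) = m.
    elim: m => [|m IH] md; first by apply/eqP; rewrite -leqn0 rank_leq_row.
    apply/eqP; rewrite eqn_leq rank_leq_row -{1}(IH (ltnW md)) ltn_neqAle.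
    rewrite mxrankS ?jets_sub // andbT; apply/eqP => rkE; apply: noex; exists m => //.
    have := row_sub ord_max (jets m.+1); rewrite rowK => /submx_trans; apply.
    by rewrite -(geq_leqif (mxrank_leqif_sup (jets_sub (leqnSn m)))) rkE.
  by have := rank_leq_col (jets d.+1); rewrite rk // ltnn.
suff : (jet k <= jets m)%MS by move/submx_trans; apply; exact: jets_sub.
have [km|mk] := ltnP k m.
  by have := row_sub (Ordinal km) (jets m); rewrite rowK.
have jm x : x = m -> (jet x <= jets m)%MS by move=> ->.
elim: k mk => [|k IH]; first by rewrite leqn0 => /eqP m0; apply: jm.
rewrite leq_eqVlt => /orP [/eqP m0|]; first exact: jm; rewrite ltnS => /IH /submxP [c jetE].
have -> : jet k.+1 = (\row_j D (c 0 j)) *m jets m + \sum_j c 0 j *: jet j.+1.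
  apply/rowP => i; rewrite !mxE summxE -big_split /=.
  have := congr1 (fun v : 'rV_d => D (v 0 i)) jetE; rewrite !mxE Dsum => ->.
  by apply: eq_bigr => j _; rewrite DM !mxE.
rewrite addmx_sub ?submxMl // summx_sub // => j _; apply: scalemx_sub.
have [jlt|] := ltnP j.+1 m; first by have := row_sub (Ordinal jlt) (jets m); rewrite rowK.
by move=> mj; apply: jm; apply/eqP; rewrite eqn_leq mj ltn_ord.
Qed.

(** The coefficient of order k of the j-th iterate is the inner product of the jets of orders k and
    j, divided by k!. The inner products with the first d jets determine a jet, as the form is
    anisotropic, and Y reconstructs it. *)
Lemma taylor_span : exists Y : 'M[K]_d, forall i, taylor (xi i) =
  \sum_(j < d) psC (Y i j) * iter j psd (\sum_l taylor (xi l) * psC (xi l)).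
Proof.
pose A := jets d; pose B := row_base A; pose N := B *m A^T.
(* A vector of the span orthogonal to the whole span is orthogonal to itself, hence zero by formal
   reality. *)
have rfN : row_free N.
  apply: inj_row_free => w; rewrite /N mulmxA => wBA.
  have /submxP [c wB] : (w *m B <= A)%MS by rewrite (submx_trans (submxMl _ _)) ?eq_row_base.
  have wBwB : (w *m B) *m (w *m B)^T = 0 by rewrite {2}wB trmx_mul mulmxA wBA mul0mx.
  have : w *m B = 0.
    apply/rowP => i; rewrite [RHS]mxE; move: i; apply: realK.
    have := congr1 (fun M : 'M_1 => M 0 0) wBwB; rewrite mxE [RHS]mxE => sq0; rewrite -[RHS]sq0.
    by apply: eq_bigr => i _; rewrite [_^T _ _]mxE expr2.
  by move/eqP; rewrite -submx0 => wB0; apply/eqP; move: wB0; rewrite submx0 mulmx_free_eq0 ?row_base_free.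
exists (pinvmx N *m B)^T => i; apply/pseriesP => k.
have /submxP [w jetE] : (jet k <= B)%MS by rewrite eq_row_base jet_sub.
have jetP : jet k *m A^T *m (pinvmx N *m B) = jet k.
  by rewrite {1}jetE -[w *m B *m _]mulmxA mulmxA -/N mulmxKp // -jetE.
have -> : taylor (xi i) k = (jet k *m A^T *m (pinvmx N *m B)) 0 i / k`!%:R.
  by rewrite jetP mxE.
rewrite mxE ps_sum mulr_suml; apply: eq_bigr => j _.
rewrite psCM.
have -> : iter j psd (\sum_l taylor (xi l) * psC (xi l)) k =
    (jet k *m A^T) 0 j / k`!%:R; last by rewrite [_^T _ _]mxE; ring.
rewrite iter_psd_sum ps_sum mxE mulr_suml; apply: eq_bigr => l _.
by rewrite iter_psd_taylorC mulrC psCM !mxE /=; ring.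
Qed.
End DerivativeSpan.

(** * Rigidity of the identity g^b = f^a *)

Section Rigidity.
Variables (a b d r : nat) (xi s : 'I_d -> K) (phi : 'I_r -> K).
Let f := \sum_i taylor (xi i) * psC (xi i).
Let g := \sum_k taylor (phi k) * psC (phi k).
Hypothesis a_gt0 : (0 < a)%N.
Hypothesis co_ab : coprime a b.
Hypothesis le_db : (d <= b)%N.
Hypothesis fg : g ^+ b = f ^+ a.
Hypothesis Ds : forall i, D (s i) = 0.
Hypothesis s1 : \sum_i s i * xi i = 1.

Let d_gt0 : (0 < d)%N.
Proof.
rewrite lt0n; apply/eqP => d0; have := s1; rewrite big1 => [/esym /eqP|i _].
  by rewrite oner_eq0.
by have := ltn_ord i; rewrite [X in (_ < X)%N]d0.
Qed.

(** The constant term of f is the sum of the squares of the xi_i, which are not all zero by [s1]. *)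
Let f_unit : exists fi, f * fi = 1.
Proof.
apply: (@ps_inv _ _ (f 0%N)^-1); apply: divff.
rewrite /f ps_sum (eq_bigr (fun i => xi i ^+ 2)) => [|i _]; last first.
  by rewrite psM0 /= fact0 divr1 expr2.
apply/eqP => /realK xi0; have := s1; rewrite big1 => [/esym /eqP|i _].
  by rewrite oner_eq0.
by rewrite xi0 mulr0.
Qed.

Let root_exists : exists H Hi N0, [/\ H * Hi = 1, H ^+ b = f, H ^+ a = g &
  forall N, (N0 <= N)%N -> decomposable H N].
Proof.
have [fi ffi] := f_unit.
have [u v uv _] := egcdnP b a_gt0; rewrite (eqP co_ab) in uv.
(* Bezout gives u a = v b + 1, so this is the common root g^u / f^v. *)
pose H := g ^+ u * fi ^+ v.
have Hb : H ^+ b = f.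
  rewrite exprMn -!exprM mulnC exprM fg -exprM mulnC uv exprD expr1 mulrAC.
  by rewrite -exprMn ffi expr1n mul1r.
have Ha : H ^+ a = g.
  rewrite exprMn -!exprM uv exprD expr1 mulnC exprM fg -exprM mulrAC.
  by rewrite [(a * v)%N]mulnC -exprMn ffi expr1n mul1r.
have b_gt0 : (0 < b)%N := leq_trans d_gt0 le_db.
exists H, (H ^+ b.-1 * fi), (b * (v * b))%N; split=> //.
  by rewrite mulrA -exprS prednK // Hb.
move=> N; rewrite mulnC -leq_divRL // => Nge.
have da : decomposable H a by exists 'I_r, phi; rewrite Ha.
have db : decomposable H b by exists 'I_d, xi; rewrite Hb.
have vN : (v * (N %% b) <= N %/ b)%N.
  by apply: leq_trans Nge; rewrite leq_mul2l (ltnW (ltn_pmod _ _)) ?orbT.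
(* For N = q b + r, the relation u a - v b = 1 gives N = (u r) a + (q - v r) b; the lower bound on N
   makes q - v r nonnegative. *)
have -> : N = ((u * (N %% b)) * a + (N %/ b - v * (N %% b)) * b)%N.
  rewrite mulnAC uv mulnBl {1}(divn_eq N b).
  have : (v * (N %% b) * b <= N %/ b * b)%N by rewrite leq_mul2r vN orbT.
  rewrite mulnDl mul1n; nia.
by apply: decomposableD; apply: decomposableM.
Qed.

(** If 1 / f is a constant, it is nonzero, and the coefficient of order 1 of taylor (xi i) / f is a
    nonzero multiple of D (xi i). *)
Let nonconst_ratio fi : f * fi = 1 -> (exists i, D (xi i) != 0) ->
  (exists2 n, (0 < n)%N & fi n != 0) \/
  (exists i, exists2 n, (0 < n)%N & (taylor (xi i) * fi) n != 0).
Proof.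
move=> ffi [i Di].
have [|noex] := pselect (exists2 n, (0 < n)%N & fi n != 0); first by left.
right; exists i, 1%N => //.
have fiE : fi = psC (fi 0%N).
  apply/pseriesP => -[|n] //=; apply/eqP; rewrite -[_ == _]negbK.
  by apply/negP => fn; apply: noex; exists n.+1.
rewrite mulrC fiE psCM [taylor _ _]/= !mulf_neq0 ?invr_eq0 ?real_fact_neq0 //.
apply/eqP => fi0.
by have /eqP := ffi; rewrite fiE fi0 rmorph0 mulr0 eq_sym oner_eq0.
Qed.

(** For large k the span of H^(b k) is finite-dimensional, contains 1, and is stable under
    multiplication by w / f for all w in the span of H^b. So every such w / f is constant, against
    [nonconst_ratio]. *)
Theorem taylor_rigidity : (exists i, D (xi i) != 0) -> False.
Proof.
move=> xi_nonconst.
have [H [Hi [N0 [HHi Hb Ha decN0]]]] := root_exists.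
have db : decomposable H b by exists 'I_d, xi; rewrite Hb.
have da : decomposable H a by exists 'I_r, phi; rewrite Ha.
have taylorb i : in_span H b (taylor (xi i)).
  by move=> l lb; apply: (annihilates_taylor (N := b) (al := xi) _ i lb); rewrite Hb.
have oneb : in_span H b 1.
  rewrite -taylor1 -s1 taylor_sum; apply: in_span_sum => i _.
  by rewrite taylorM (taylor_const (Ds i)); apply: in_spanZ.
(* Derivatives of f = H^b of order at most M keep the factor H^e, and e > 0 because d <= b. *)
pose M := d.-1; pose e := (b - M)%N.
have Mb : (M <= b)%N by rewrite (leq_trans _ le_db) // leq_pred.
have e_gt0 : (0 < e)%N by rewrite subn_gt0 /M prednK.
have bE : b = (M + e)%N by rewrite /e subnKC.
have jetdeg (j : 'I_d) : exists Q, degree_le H N0 Q M /\ iter j psd f = H ^+ e * Q.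
  have jd := ltn_ord j; have jM : (j <= M)%N by rewrite -ltnS /M prednK.
  have [P Pj PE] := iter_psd_pow decN0 (leq_trans jM Mb).
  exists (H ^+ (M - j) * P); split.
    rewrite -[X in degree_le _ _ _ X](subnK jM); apply: degree_leM Pj => //.
    by rewrite -[X in degree_le _ _ _ X]muln1; apply: degree_leX => //; apply: degree_le_self.
  by rewrite -Hb PE mulrA -exprD /e addnBA // subnK.
have [Y YE] := taylor_span xi.
have Rex i : exists Rc : pseries K * nat, [/\ taylor (xi i) = H ^+ e * Rc.1, (N0 <= Rc.2)%N &
    forall m, in_span H (M * m + Rc.2) (Rc.1 ^+ m * H ^+ Rc.2)].
  have [Q QE] := choice jetdeg.
  have [c c0 cE] : degree_le H N0 (\sum_(j < d) psC (Y i j) * Q j) M.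
    apply: degree_le_sum => // j; rewrite -[M]add0n; apply: degree_leM (QE j).1 => //.
    exact: degree_leC.
  exists (\sum_(j < d) psC (Y i j) * Q j, c); split=> //=.
  rewrite YE mulr_sumr; apply: eq_bigr => j _.
  by rewrite -/f (QE j).2 mulrCA.
have [Rc RcE] := choice Rex.
pose C := (\sum_i (Rc i).2)%N.
have C_ge : (N0 <= C)%N.
  have [_ c0 _] := RcE (Ordinal d_gt0); apply: leq_trans c0 _.
  by rewrite /C (bigD1 (Ordinal d_gt0)) //= leq_addr.
(* Grouping equal factors makes the additive constant [C] independent of k. *)
have monom k (I : {ffun 'I_k -> 'I_d}) :
    in_span H (M * k + C) (\prod_j (Rc (I j)).1 * H ^+ C).
  pose al i := #|[pred j | I j == i]|.
  have alk : (\sum_i al i = k)%N.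
    rewrite -[RHS](card_ord k) -sum1_card (partition_big I predT) //=.
    by apply: eq_bigr => i _; rewrite sum1_card.
  have -> : \prod_j (Rc (I j)).1 = \prod_i (Rc i).1 ^+ al i.
    rewrite (partition_big I predT) //=; apply: eq_bigr => i _.
    rewrite (eq_bigr (fun=> (Rc i).1)) => [|j /eqP -> //].
    by rewrite prodr_const.
  rewrite -[X in (M * X)%N]alk; apply: (degree_le_prod decN0).
    by move=> i; have [] := RcE i.
  by move=> i m; have [] := RcE i.
(* With this k, removing C + b from e k still leaves an exponent N1 >= N0. *)
pose k := (C + N0 + b)%N.
pose N1 := (e * k - C - b)%N.
have ek : (k <= e * k)%N by rewrite leq_pmull.
have N1E : (C + N1 + b = e * k)%N by rewrite /N1; move: ek; rewrite /k; lia.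
have N1_ge : (N0 <= N1)%N by rewrite /N1; move: ek; rewrite /k; lia.
pose mon (I : {ffun 'I_k -> 'I_d}) := \prod_j xi (I j).
have Hbk : H ^+ (b * k) = \sum_I taylor (mon I) * psC (mon I).
  rewrite exprM Hb -[in LHS](card_ord k) -prodr_const /f bigA_distr_bigA /=.
  by apply: eq_bigr => I _; rewrite big_split /= taylor_prod rmorph_prod.
have dbk : decomposable H (b * k) by rewrite mulnC; apply: decomposableM.
have HiE n m : H ^+ (n + m) * Hi ^+ n = H ^+ m.
  by rewrite exprD mulrAC -exprMn HHi expr1n mul1r.
(* By duality it suffices to treat products of k expansions [taylor (xi i)]: they are divisible by
   H^(e k), and [monom] controls the quotient. *)
have shift y : in_span H (b * k) y -> in_span H (M * k + C) (H ^+ C * Hi ^+ (e * k) * y).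
  move=> yZ l ln; apply: (yZ (fun E => l (H ^+ C * Hi ^+ (e * k) * E))).
  apply: (taylor_annihilates Hbk); first exact: (functM ln.1).
  move=> I; rewrite taylor_prod (eq_bigr (fun j => H ^+ e * (Rc (I j)).1)); last first.
    by move=> j _; have [] := RcE (I j).
  rewrite big_split prodr_const card_ord -exprM /=.
  rewrite (_ : _ * _ = H ^+ (e * k + 0) * Hi ^+ (e * k) * (\prod_j (Rc (I j)).1 * H ^+ C)).
    by rewrite HiE mul1r; apply: (monom k I).
  by rewrite addn0; ring.
(* The exponents balance: C - e k + N1 = - b, while (M k + C) + (N1 + b) = b k. *)
have stable w y : in_span H b w -> in_span H (b * k) y -> in_span H (b * k) (y * (w * Hi ^+ b)).
  move=> wZ yZ.
  have -> : y * (w * Hi ^+ b) = H ^+ C * Hi ^+ (e * k) * y * (H ^+ N1 * w).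
    rewrite -N1E (exprD _ (C + N1)) -[X in _ = X](_ : H ^+ (C + N1 + 0) * Hi ^+ (C + N1) * (y * (w * Hi ^+ b)) = _).
      by rewrite HiE mul1r.
    by rewrite addn0 exprD; ring.
  have -> : (b * k = (M * k + C) + (N1 + b))%N by rewrite [in LHS]bE mulnDl -N1E; lia.
  apply: in_spanM; first by apply: decN0; lia.
  - by apply: decomposableD => //; apply: decN0.
  - exact: shift.
  - by apply: in_spanM => //; [exact: decN0|exact: in_span_self].
have one_bk : in_span H (b * k) 1.
  elim: (k) => [|n IH]; first by rewrite muln0 -(expr0 H); apply: in_span_self.
  rewrite mulnS -[1]mulr1; apply: in_spanM => //.
  by rewrite mulnC; apply: decomposableM.
have finite_dim w : in_span H b w -> (exists2 n, (0 < n)%N & (w * Hi ^+ b) n != 0) -> False.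
  move=> wZ [n n0 wn]; set z := w * Hi ^+ b in wn.
  pose z0 := z - psC (z 0%N).
  have z0P : forall j, in_span H (b * k) (z0 ^+ j).
    elim=> [|j IH]; first by rewrite expr0.
    rewrite exprSr mulrBr; apply: in_spanB; first exact: stable.
    by rewrite mulrC; apply: in_spanZ.
  have z00 : z0 0%N = 0 by rewrite psD psN /= subrr.
  have z0n : exists m, z0 m != 0.
    by exists n; rewrite psD psN /=; case: n n0 wn => // n _; rewrite subr0.
  have [l [lP l0 [j /eqP]]] := powers_infinite_dim (fun I => taylor (mon I)) z00 z0n.
  by apply; apply: z0P; apply: (taylor_annihilates Hbk).
have ffi : f * Hi ^+ b = 1 by rewrite -Hb -exprMn HHi expr1n.
have [fin|[i fin]] := nonconst_ratio ffi xi_nonconst.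
  by apply: (finite_dim 1) => //; rewrite mul1r.
exact: (finite_dim (taylor (xi i))).
Qed.
End Rigidity.
End TaylorSeries.

(** * Positive kernels *)

Section PositiveKernels.
Variable R : rcfType.

Definition quad (T : finType) (g : T -> T -> R) (c : T -> R) : R :=
  \sum_s \sum_t c s * c t * g s t.
(** Families over a finite type may repeat points, so any point can be adjoined to a family. *)
Definition positive_kernel (X : Type) (g : X -> X -> R) : Prop :=
  (forall x y, g x y = g y x) /\
  forall (T : finType) (p : T -> X) (c : T -> R),
    0 <= quad (fun s t => g (p s) (p t)) c.

(** Induction through the Schur complement of the first diagonal entry. *)
Lemma cholesky N (G : 'M[R]_N) : G^T = G ->
  (forall v : 'rV_N, 0 <= (v *m G *m v^T) 0 0) -> exists B : 'M_N, G = B *m B^T.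
Proof.
elim: N G => [|N IH] G Gsym Gpos.
  by exists 0; apply/matrixP => -[].
pose al : R := G 0 0; pose be : 'rV[R]_N := ursubmx (G : 'M_(1 + N)).
pose ga : 'M[R]_N := drsubmx (G : 'M_(1 + N)).
have GE : G = block_mx al%:M be be^T ga :> 'M_(1 + N).
  rewrite -[LHS](@submxK _ 1 N 1 N); congr block_mx.
    by apply/rowP => i; rewrite !mxE !ord1 /= mulr1n; congr (G _ _); apply: val_inj.
  by rewrite /be trmx_ursub Gsym.
have gasym : ga^T = ga by rewrite /ga trmx_drsub Gsym.
have Q (x : R) (w : 'rV_N) :
    0 <= al * x ^+ 2 + x * (be *m w^T) 0 0 *+ 2 + (w *m ga *m w^T) 0 0.
  have := Gpos (row_mx x%:M w).
  have -> : row_mx x%:M w *m G *m (row_mx x%:M w)^T =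
      row_mx x%:M w *m (block_mx al%:M be be^T ga : 'M_(1 + N)) *m (row_mx x%:M w)^T.
    by rewrite -GE.
  rewrite mul_row_block tr_row_mx mul_row_col.
  have beT : w *m be^T = (be *m w^T)^T by rewrite trmx_mul trmxK.
  rewrite tr_scalar_mx mul_mx_scalar !mul_scalar_mx mulmxDl -scalemxAl beT.
  set bw := be *m w^T; set wgw := w *m ga *m w^T; congr (0 <= _).
  by rewrite !mxE eqxx mulr1n; ring.
have al_ge0 : 0 <= al.
  by have := Q 1 0; rewrite trmx0 !mulmx0 !mxE expr1n mulr1 mulr0 mul0rn !addr0.
(* With a zero pivot the form is affine in x and bounded below, so its slope vanishes. *)
have be0 : al = 0 -> be = 0.
  move=> a0; apply/rowP => i; rewrite [RHS]mxE.
  have beE : (be *m (delta_mx 0 i : 'rV_N)^T) 0 0 = be 0 i.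
    by rewrite trmx_delta -colE mxE.
  pose q := ((delta_mx 0 i : 'rV_N) *m ga *m (delta_mx 0 i : 'rV_N)^T) 0 0.
  have H x : 0 <= x * be 0 i *+ 2 + q by have := Q x (delta_mx 0 i); rewrite a0 mul0r add0r beE.
  apply/eqP; apply: contraT => bi0.
  have := H (- (q + 1) / (be 0 i)); rewrite divfK //.
  by have := H 0; rewrite mul0r mul0rn add0r; lra.
have gapos (w : 'rV_N) : 0 <= (w *m (ga - al^-1 *: (be^T *m be)) *m w^T) 0 0.
  have -> : w *m (ga - al^-1 *: (be^T *m be)) *m w^T =
      w *m ga *m w^T - al^-1 *: ((be *m w^T)^T *m (be *m w^T)).
    by rewrite mulmxBr mulmxBl -scalemxAr -scalemxAl trmx_mul trmxK !mulmxA.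
  (* The first value minimizes the form in x; x = 0 serves the case of a zero pivot. *)
  have := Q (- (be *m w^T) 0 0 / al) w; have := Q 0 w.
  move: (be *m w^T) (w *m ga *m w^T) => bw wgw.
  have -> : (wgw - al^-1 *: (bw^T *m bw)) 0 0 = wgw 0 0 - al^-1 * bw 0 0 ^+ 2.
    by rewrite !mxE big_ord1 mxE expr2.
  have [->|a0] := eqVneq al 0; first by rewrite !mul0r mul0rn !add0r invr0 mul0r subr0.
  by move=> _; congr (0 <= _); field.
have [|B' B'E] := IH _ _ gapos.
  by rewrite linearB linearZ /= trmx_mul trmxK gasym.
pose s := Num.sqrt al.
have ss : s * s = al by rewrite -expr2 sqr_sqrtr.
(* For s = 0 both sides vanish, as the inverse of 0 is 0 and [be] is 0. *)
have sbe : s *: (s^-1 *: be) = be.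
  have [s0|s0] := eqVneq s 0; last by rewrite scalerA divff ?scale1r.
  by rewrite s0 scale0r be0 // -ss s0 mul0r.
exists (block_mx s%:M 0 (s^-1 *: be^T) B' : 'M_(1 + N)).
apply: etrans GE _.
change (block_mx al%:M be be^T ga = block_mx s%:M 0 (s^-1 *: be^T) B'
  *m (block_mx s%:M 0 (s^-1 *: be^T) B')^T :> 'M_(1 + N)).
rewrite tr_block_mx trmx0 tr_scalar_mx mulmx_block !mulmx0 !mul0mx !addr0.
have sbe' : s *: (s^-1 *: be^T) = be^T by rewrite -[in RHS]sbe [RHS]linearZ /= [(_ *: be)^T]linearZ.
congr block_mx.
- by rewrite -scalar_mxM ss.
- by rewrite linearZ /= trmxK mul_scalar_mx sbe.
- by rewrite mul_mx_scalar sbe'.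
- rewrite -B'E linearZ /= trmxK -scalemxAl -scalemxAr scalerA -invfM ss.
  by rewrite addrC subrK.
Qed.

Section Kernels.
Variable X : Type.
Implicit Type g : X -> X -> R.

Lemma positive_kernel_factor g (T : finType) (p : T -> X) : positive_kernel g ->
  exists B : T -> 'I_#|T| -> R, forall s t, g (p s) (p t) = \sum_k B s k * B t k.
Proof.
move=> [gsym gpos].
pose G := \matrix_(i < #|T|, j < #|T|) g (p (enum_val i)) (p (enum_val j)).
have [||B BE] := @cholesky _ G.
- by apply/matrixP => i j; rewrite !mxE gsym.
- move=> v; have := gpos 'I_#|T| (fun i => p (enum_val i)) (fun i => v 0 i).
  rewrite /quad exchange_big mxE; congr (0 <= _); apply: eq_bigr => j _.
  by rewrite !mxE mulr_suml; apply: eq_bigr => i _; rewrite !mxE; ring.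
exists (fun t k => B (enum_rank t) k) => s t.
have := congr1 (fun M : 'M_#|T| => M (enum_rank s) (enum_rank t)) BE.
by rewrite !mxE !enum_rankK => ->; apply: eq_bigr => k _; rewrite mxE.
Qed.

(** Schur product theorem: a Gram factorization of g turns the form of the product into a sum of
    forms of h. *)
Lemma positive_kernelM g h : positive_kernel g -> positive_kernel h ->
  positive_kernel (fun x y => g x y * h x y).
Proof.
move=> gP [hsym hpos]; split=> [x y|T p c]; first by rewrite gP.1 hsym.
have [B BE] := positive_kernel_factor p gP.
have -> : quad (fun s t => g (p s) (p t) * h (p s) (p t)) c =
    \sum_k quad (fun s t => h (p s) (p t)) (fun t => c t * B t k).
  rewrite /quad [RHS]exchange_big /=; apply: eq_bigr => s _.
  rewrite [RHS]exchange_big /=; apply: eq_bigr => t _.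
  by rewrite BE mulr_suml mulr_sumr; apply: eq_bigr => k _; ring.
by apply: sumr_ge0 => k _; apply: hpos.
Qed.

Lemma positive_kernel1 : positive_kernel (fun _ _ : X => 1).
Proof.
split=> // T p c; rewrite /quad.
rewrite (_ : \sum_s _ = (\sum_s c s) ^+ 2) ?sqr_ge0 // expr2 mulr_suml.
by apply: eq_bigr => s _; rewrite mulr_sumr; apply: eq_bigr => t _; rewrite mulr1.
Qed.

Lemma positive_kernelX g n : positive_kernel g -> positive_kernel (fun x y => g x y ^+ n).
Proof.
move=> gP; elim: n => [|n IH]; first exact: positive_kernel1.
by under eq_fun do under eq_fun do rewrite exprS; apply: positive_kernelM.
Qed.

Lemma quad_option (T : finType) (h : option T -> option T -> R) (c : option T -> R) :
  (forall s t, h s t = h t s) ->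
  quad h c = c None ^+ 2 * h None None
    + c None * (\sum_t c (Some t) * h (Some t) None) *+ 2
    + quad (fun s t => h (Some s) (Some t)) (fun t => c (Some t)).
Proof.
move=> hsym.
have big_opt (F : option T -> R) : \sum_o F o = F None + \sum_t F (Some t).
  rewrite (bigD1 None) //=; congr (_ + _).
  rewrite (reindex_omap Some id) => [|[]//].
  by apply: eq_bigl => t; rewrite eqxx.
rewrite /quad big_opt big_opt.
under [X in _ + X]eq_bigr do rewrite big_opt.
rewrite big_split /= addrA; congr (_ + _); rewrite -expr2 -addrA; congr (_ + _).
rewrite mulr2n mulr_sumr; congr (_ + _); apply: eq_bigr => t _; last by ring.
by rewrite hsym; ring.
Qed.

(* Schur complement at a point where the kernel is normalized. *)
Lemma positive_kernelB1 g o : positive_kernel g -> (forall x, g x o = 1) ->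
  positive_kernel (fun x y => g x y - 1).
Proof.
move=> [gsym gpos] go; split=> [x y|T p c]; first by rewrite gsym.
pose q := oapp p o; pose S := \sum_t c t.
have := gpos _ q (oapp c (- S)); rewrite quad_option => [|s t]; last exact: gsym.
rewrite /= go mulr1 (eq_bigr c) => [|t _]; last by rewrite go mulr1.
rewrite -/S; congr (0 <= _).
rewrite [in RHS]/quad; under [RHS]eq_bigr do under eq_bigr do rewrite mulrBr mulr1.
under [RHS]eq_bigr do rewrite sumrB -mulr_sumr -/S.
by rewrite sumrB -mulr_suml -/S /quad; ring.
Qed.

(** Cauchy-Schwarz: adjoining y with weight x gives the polynomial x^2 g(y, y) + 2 x L, which is
    nonnegative only if L = 0. *)
Lemma positive_kernel_null g (T : finType) (p : T -> X) c y : positive_kernel g ->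
  quad (fun s t => g (p s) (p t)) c = 0 -> \sum_t c t * g (p t) y = 0.
Proof.
move=> [gsym gpos] q0; set L := \sum_t _.
have H x : 0 <= x ^+ 2 * g y y + x * L *+ 2.
  have := gpos _ (oapp p y) (oapp c x); rewrite quad_option => [|s t]; last exact: gsym.
  by rewrite /= q0 addr0.
have g0 : 0 <= g y y by have := H 1; have := H (-1); rewrite sqrrN expr1n; lra.
apply/eqP; apply: contraT => L0.
have L2 : 0 < L ^+ 2 by rewrite exprn_even_gt0 // L0 orbT.
have := H (- L / (g y y + 1)).
have gy : 0 < g y y + 1 by lra.
have -> : (- L / (g y y + 1)) ^+ 2 * g y y + - L / (g y y + 1) * L *+ 2 =
   - (L ^+ 2 / (g y y + 1) ^+ 2 * (g y y + 2)) by field; lra.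
have pos : 0 < L ^+ 2 / (g y y + 1) ^+ 2 * (g y y + 2).
  by apply: mulr_gt0; [apply: divr_gt0 => //; apply: exprn_gt0|lra].
by rewrite oppr_ge0 leNgt pos.
Qed.

(** The difference g^(m + 1) - g^m = (g - 1) g^m is positive by the Schur product theorem, so the
    forms of the powers of g increase with the exponent. *)
Lemma quad_power_null g o n (T : finType) (p : T -> X) c : positive_kernel g ->
  (forall x, g x o = 1) -> quad (fun s t => g (p s) (p t) ^+ n.+1) c = 0 ->
  quad (fun s t => g (p s) (p t)) c = 0.
Proof.
move=> gP go q0; apply/eqP; rewrite eq_le gP.2 andbT -[X in _ <= X]q0.
elim: n {q0} => [|n IH].
  by rewrite le_eqVlt; apply/orP; left; apply/eqP; rewrite /quad; do 2!apply: eq_bigr => ? _.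
apply: le_trans IH _; rewrite -subr_ge0.
have [_ /(_ _ p c)] := positive_kernelM (positive_kernelB1 gP go) (positive_kernelX n.+1 gP).
congr (0 <= _); rewrite /quad -sumrB; apply: eq_bigr => s _.
by rewrite -sumrB; apply: eq_bigr => t _; rewrite [in RHS]exprS; ring.
Qed.

(** Vectors outside the current span are adjoined one by one; each lowers the codimension. *)
Lemma spanning_sample (F : fieldType) (Y : Type) K (e : Y -> 'rV[F]_K) :
  exists n (p : 'I_n -> Y), forall x, (e x <= \matrix_i e (p i))%MS.
Proof.
have [k] : exists k, exists n (p : 'I_n -> Y), (K - \rank (\matrix_i e (p i)) <= k)%N.
  by exists K, 0%N, (fun i : 'I_0 => match i with Ordinal _ i0 => False_rect _ (notF i0) end); apply: leq_subr.
elim: k => [|k IH] [n [p np]].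
  exists n, p => x; apply: submx_full.
  by rewrite /row_full eqn_leq rank_leq_col -subn_eq0 -leqn0.
have [//|/existsNP [x xP]] := pselect (forall x, (e x <= \matrix_i e (p i))%MS).
  by exists n, p.
apply: IH; exists n.+1, (fun i => oapp p x (unlift ord0 i)).
set A := \matrix_i e (p i) in np xP; set B := \matrix_i _.
have AB : (A <= B)%MS.
  apply/row_subP => i; have := row_sub (lift ord0 i) B.
  by rewrite !rowK liftK.
have xB : (e x <= B)%MS by have := row_sub ord0 B; rewrite rowK unlift_none.
have : (\rank A < \rank B)%N.
  rewrite ltn_neqAle mxrankS // andbT; apply/negP => rAB; apply: xP.
  by apply: submx_trans xB _; rewrite -(geq_leqif (mxrank_leqif_sup AB)) (eqP rAB).
by have := rank_leq_col B; lia.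
Qed.

Lemma gram_of_features g K (e : X -> 'rV[R]_K) : positive_kernel g ->
  (forall (T : finType) (p : T -> X) c, \sum_t c t *: e (p t) = 0 ->
     forall y, \sum_t c t * g (p t) y = 0) ->
  exists r (Th : 'M[R]_(K, r)), forall x y,
    g x y = \sum_k (e x *m Th) 0 k * (e y *m Th) 0 k.
Proof.
move=> gP dom; have [n [p pP]] := spanning_sample e.
have [B BE] := positive_kernel_factor p gP.
pose E := \matrix_i e (p i); pose w x := e x *m pinvmx E.
have eE x : e x = w x *m E by rewrite /w mulmxKpV.
have gw x y : g x y = \sum_i w x 0 i * g (p i) y.
  have := dom _ (oapp p x) (oapp (fun i => - w x 0 i) 1) _ y.
  have big_opt (V : nmodType) (F : option 'I_n -> V) : \sum_o F o = F None + \sum_t F (Some t).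
    rewrite (bigD1 None) //=; congr (_ + _).
    rewrite (reindex_omap Some id) => [|[]//].
    by apply: eq_bigl => t; rewrite eqxx.
  rewrite !big_opt /= scale1r mul1r => H; apply/eqP; rewrite -subr_eq0; apply/eqP.
  rewrite -sumrN (eq_bigr (fun i => - w x 0 i * g (p i) y)) => [|i _]; last by rewrite mulNr.
  apply: H; rewrite {1}eE mulmx_sum_row -big_split big1 // => i _.
  by rewrite rowK /= scaleNr addrN.
pose Bm := \matrix_(i, k) B i k.
exists _, (pinvmx E *m Bm) => x y; rewrite gw.
rewrite (eq_bigr (fun i => \sum_j w x 0 i * (w y 0 j * \sum_k B i k * B j k))).
  under eq_bigr do under eq_bigr do rewrite mulr_sumr mulr_sumr.
  under eq_bigr do rewrite exchange_big.
  rewrite exchange_big; apply: eq_bigr => k _ /=.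
  have wB z : (e z *m (pinvmx E *m Bm)) 0 k = \sum_i w z 0 i * B i k.
    by rewrite mulmxA -/(w z) mxE; apply: eq_bigr => i _; rewrite [Bm _ _]mxE.
  rewrite !wB mulr_suml; apply: eq_bigr => i _.
  by rewrite mulr_sumr; apply: eq_bigr => j _; ring.
move=> i _; rewrite -mulr_sumr; congr (_ * _).
rewrite gP.1 gw; apply: eq_bigr => j _; rewrite -BE gP.1 //.
Qed.
End Kernels.

(** The features are the monomials of degree a, indexed by words of length a. *)
Lemma power_of_gram_is_gram (X : Type) (d a b : nat) (x : X -> 'I_d -> R) (o : X)
    (g : X -> X -> R) : (0 < b)%N -> positive_kernel g -> (forall y, g y o = 1) ->
  (forall y z, g y z ^+ b = (\sum_i x y i * x z i) ^+ a) ->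
  exists r (Th : {ffun 'I_a -> 'I_d} -> 'I_r -> R), forall y z,
    g y z = \sum_k (\sum_I Th I k * \prod_j x y (I j)) * (\sum_I Th I k * \prod_j x z (I j)).
Proof.
case: b => // b _ gP go gF.
pose J := {ffun 'I_a -> 'I_d}.
pose e y : 'rV[R]_#|J| := \row_n \prod_j x y ((enum_val n : J) j).
have [T p c ce y|r [Th ThE]] := gram_of_features (e := e) gP.
  apply: (positive_kernel_null _ gP); apply: (quad_power_null (n := b) gP go).
  rewrite /quad; under eq_bigr do under eq_bigr do rewrite gF.
  (* The kernel (x . y)^a is the Gram kernel of the features, so its form is a sum of squares of
     coordinates of the vanishing combination [ce]. *)
  transitivity (\sum_(n < #|J|) (\sum_t c t * e (p t) 0 n) ^+ 2).
    under [RHS]eq_bigr => n _.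
      rewrite expr2 mulr_suml.
      under eq_bigr do rewrite mulr_sumr.
      over.
    rewrite [RHS]exchange_big; apply: eq_bigr => s _; rewrite [RHS]exchange_big; apply: eq_bigr => t _ /=.
    rewrite -[in LHS](card_ord a) -prodr_const bigA_distr_bigA /= mulr_sumr.
    rewrite (reindex (fun n : 'I_#|J| => enum_val n)) /=; last first.
      by apply: onW_bij; exact: enum_val_bij.
    by apply: eq_bigr => n _; rewrite big_split /= !mxE; ring.
  apply: big1 => n _; rewrite (_ : \sum_t _ = 0) ?expr0n //.
  transitivity ((\sum_t c t *: e (p t)) 0 n); last by rewrite ce mxE.
  by rewrite summxE; apply: eq_bigr => t _; rewrite [in RHS]mxE.
exists r, (fun I k => Th (enum_rank I) k) => y z; rewrite ThE; apply: eq_bigr => k _.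
suff H y' : (e y' *m Th) 0 k = \sum_I Th (enum_rank I) k * \prod_j x y' (I j).
  by rewrite !H.
rewrite mxE (reindex (fun n : 'I_#|J| => enum_val n)) /=; last first.
  by apply: onW_bij; exact: enum_val_bij.
by apply: eq_bigr => n _; rewrite mxE enum_valK mulrC.
Qed.
End PositiveKernels.

(** * A residue field at a generic point *)

Lemma fraction_surj (R : idomainType) (z : {fraction R}) :
  exists n e : R, e != 0 /\ z = tofrac n / tofrac e.
Proof.
elim/quotW: z => x; exists \n_x, \d_x; split; first exact: denom_ratioP.
apply: (mulIf (_ : tofrac \d_x != 0)); first by rewrite tofrac_eq0 denom_ratioP.
rewrite divfK ?tofrac_eq0 ?denom_ratioP //; unlock tofrac.
rewrite -[LHS]FracField.pi_mul; apply/eqmodP; rewrite /= FracField.equivfE.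
by rewrite /FracField.mulf !numden_Ratio ?(oner_eq0, mulf_neq0, denom_ratioP) // !mulr1 mulrC.
Qed.

(** * Fraction field of the quotient by a prime ideal *)

Section PrimeQuotientFraction.
Variables (P : comNzRingType) (I : prime_idealr P).
Definition prime_quot : Type := {ideal_quot I}.
HB.instance Definition _ := GRing.ComNzRing.on prime_quot.

Definition quot_unit : {pred prime_quot} := fun x => `[< exists y, y * x = 1 >].
Definition quot_inv (x : prime_quot) : prime_quot :=
  match pselect (exists y, y * x = 1) with
  | left xP => projT1 (cid xP)
  | right _ => x
  end.

Fact quot_mulVx : {in quot_unit, left_inverse 1 quot_inv *%R}.
Proof.
move=> x /asboolP xu; rewrite /quot_inv; case: pselect => // xP.
exact: projT2 (cid xP).
Qed.
Fact quot_unitPl x y : y * x = 1 -> quot_unit x.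
Proof. by move=> yx; apply/asboolP; exists y. Qed.
Fact quot_inv_out : {in [predC quot_unit], quot_inv =1 id}.
Proof.
move=> x; rewrite inE /= => /negP xu; rewrite /quot_inv; case: pselect => // xP.
by case: xu; apply/asboolP.
Qed.
HB.instance Definition _ := GRing.ComNzRing_hasMulInverse.Build prime_quot
  quot_mulVx quot_unitPl quot_inv_out.
HB.instance Definition _ := GRing.ComUnitRing_isIntegral.Build prime_quot
  (@Quotient.rquot_IdomainAxiom P I).

Definition to_prime_quot (p : P) : prime_quot := \pi_{ideal_quot I}%qT p.

Fact to_prime_quot_is_additive : zmod_morphism to_prime_quot.
Proof. by move=> x y; rewrite /to_prime_quot !piE. Qed.
Fact to_prime_quot_is_multiplicative : monoid_morphism to_prime_quot.
Proof. by split=> [|x y]; rewrite /to_prime_quot !piE. Qed.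
HB.instance Definition _ := GRing.isZmodMorphism.Build P prime_quot
  to_prime_quot to_prime_quot_is_additive.
HB.instance Definition _ := GRing.isMonoidMorphism.Build P prime_quot
  to_prime_quot to_prime_quot_is_multiplicative.

Definition to_residue : P -> {fraction prime_quot} := @tofrac prime_quot \o to_prime_quot.
HB.instance Definition _ := GRing.RMorphism.on to_residue.

Lemma to_residue_eq0 p : (to_residue p == 0) = (p \in I).
Proof.
rewrite /to_residue /= tofrac_eq0 -[0](rmorph0 to_prime_quot).
by rewrite /to_prime_quot -Quotient.idealrBE subr0.
Qed.

Lemma to_residue_surj z : exists p q, to_residue q != 0 /\ z = to_residue p / to_residue q.
Proof.
have piS (u : prime_quot) : exists p, to_prime_quot p = u.
  by exists (repr (u : {ideal_quot I})); rewrite /to_prime_quot reprK.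
have [n [e [e0 ->]]] := fraction_surj z.
have [[p pE] [q qE]] := (piS n, piS e).
by exists p, q; rewrite /to_residue /= pE qE tofrac_eq0.
Qed.
End PrimeQuotientFraction.

Lemma residue_field (P : comNzRingType) (I : P -> Prop) :
  I 0 -> (forall x y, I x -> I y -> I (x - y)) -> (forall a x, I x -> I (a * x)) ->
  ~ I 1 -> (forall x y, I (x * y) -> I x \/ I y) ->
  exists (K : fieldType) (iota : {rmorphism P -> K}),
    (forall p, iota p = 0 <-> I p) /\
    (forall z, exists p q, iota q != 0 /\ z = iota p / iota q).
Proof.
move=> I0 IB IM I1 Iprime; pose J : P -> bool := fun x => `[< I x >].
have Jideal : idealr_closed J.
  split; [exact/asboolP|by apply/negP => /asboolP|].
  move=> a x y /asboolP Ix /asboolP Iy; apply/asboolP.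
  by rewrite -[y]opprK; apply: (IB); [exact: IM|rewrite -sub0r; exact: IB].
have Jprime : prime_idealr_closed J.
  by move=> x y /asboolP /Iprime [] H; apply/orP; [left|right]; apply/asboolP.
pose m1 := isIdealr.Build P J Jideal.
pose m2 := isPrimeIdealrClosed.Build P J Jprime.
pose JJ : prime_idealr P := HB.pack J m1 m2.
exists {fraction (prime_quot JJ)}, (to_residue JJ); split=> [p|z].
  split=> [/eqP|Ip]; first by rewrite to_residue_eq0 => /asboolP.
  by apply/eqP; rewrite to_residue_eq0; apply/asboolP.
exact: to_residue_surj.
Qed.

(** * The generic point of a sequence along an ultrafilter *)

Module GenericPoint.
Import mpoly.

(** The property holds for constants and variables and passes to sums and products. *)
Lemma hadamard (K : fieldType) d (xi : 'I_d -> K) (f : {mpoly K[d]}) :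
  exists Q : 'I_d -> {mpoly K[d]},
    f = (f.@[xi])%:MP + \sum_j Q j * ('X_j - (xi j)%:MP) /\
    forall j, (Q j).@[xi] = (f^`M(j)).@[xi].
Proof.
pose Had g := exists Q : 'I_d -> {mpoly K[d]},
    g = (g.@[xi])%:MP + \sum_j Q j * ('X_j - (xi j)%:MP) /\
    forall j, (Q j).@[xi] = (g^`M(j)).@[xi].
have HadC c : Had c%:MP.
  exists (fun=> 0); split=> [|j]; last by rewrite mderivC !meval0.
  by rewrite mevalC big1 ?addr0 // => j _; rewrite mul0r.
have HadX i : Had 'X_i.
  exists (fun j => (j == i)%:R); split=> [|j].
    rewrite mevalXU (bigD1 i) //= eqxx mul1r big1 => [|j /negbTE ->]; last by rewrite mul0r.
    by rewrite addr0 addrC subrK.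
  rewrite mderivX mnmE eq_sym; case: eqP => [->|_]; last by rewrite scale0r !meval0.
  have -> : (U_(j) - U_(j) = 0 :> 'X_{1..d})%MM.
    by apply/mnmP => k; rewrite mnmBE subnn mnm0E.
  by rewrite scale1r mpolyX0 !meval1.
have HadD g h : Had g -> Had h -> Had (g + h).
  move=> [Q [gE Qd]] [Q' [hE Q'd]]; exists (fun j => Q j + Q' j); split=> [|j]; last first.
    by rewrite mderivD !mevalD Qd Q'd.
  rewrite {1}gE {1}hE mevalD mpolyCD.
  under [in RHS]eq_bigr do rewrite mulrDl.
  by rewrite big_split /=; ring.
have HadM g h : Had g -> Had h -> Had (g * h).
  move=> [Q [gE Qd]] [Q' [hE Q'd]].
  exists (fun j => Q j * h + (g.@[xi])%:MP * Q' j); split=> [|j]; last first.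
    by rewrite mderivM !mevalD !mevalM mevalC Qd Q'd.
  under eq_bigr do rewrite mulrDl -mulrA [h * _]mulrC mulrA -[_ * Q' _ * _]mulrA.
  rewrite big_split /= -mulr_suml -mulr_sumr mevalM mpolyCM.
  set G := (g.@[xi])%:MP; set Hc := (h.@[xi])%:MP.
  have {1}-> : g = G + \sum_j Q j * ('X_j - (xi j)%:MP) by [].
  set SQ := \sum_j Q j * _; set SQ' := \sum_j Q' j * _.
  have hE' : h = Hc + SQ' by [].
  by rewrite {1}hE' [in RHS]hE'; ring.
have HadX' g n : Had g -> Had (g ^+ n).
  move=> Hg; elim: n => [|n IH]; first by rewrite expr0 -mpolyC1; apply: HadC.
  by rewrite exprS; apply: HadM.
rewrite -/(Had f) (mpolyE f).
elim/big_rec: _ => [|m g _ Hg]; first by rewrite -mpolyC0; apply: HadC.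
apply: (HadD) => //; rewrite -mul_mpolyC; apply: (HadM); first exact: HadC.
rewrite mpolyXE_id; elim/big_rec: _ => [|i h _ Hh]; first by rewrite -mpolyC1; apply: HadC.
by apply: (HadM) => //; apply: (HadX').
Qed.

Section GenericPoint.
Variables (R : realFieldType) (d : nat) (x : nat -> 'I_d -> R).
(* [ae] is a nonprincipal ultrafilter on the indices. *)
Variable ae : (nat -> Prop) -> Prop.
Hypothesis aeS : forall A B : nat -> Prop, (forall n, A n -> B n) -> ae A -> ae B.
Hypothesis aeI : forall A B, ae A -> ae B -> ae (fun n => A n /\ B n).
Hypothesis ae_or : forall A, ae A \/ ae (fun n => ~ A n).
Hypothesis ae_ex : forall A, ae A -> exists n, A n.
Hypothesis ae_neq : forall m, ae (fun n => n <> m).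
Hypothesis x_inj : injective x.

Lemma ae_true (A : nat -> Prop) : (forall n, A n) -> ae A.
Proof. by move=> AT; have [//|/ae_ex [n]] := ae_or A. Qed.

Lemma ae_forall (T : finType) (A : T -> nat -> Prop) :
  (forall t, ae (A t)) -> ae (fun n => forall t, A t n).
Proof.
move=> AT; suff H (s : seq T) : ae (fun n => forall t, t \in s -> A t n).
  by apply: aeS (H (enum T)) => n nP t; apply: nP; rewrite mem_enum.
elim: s => [|t s IH]; first exact: ae_true.
apply: aeS (aeI (AT t) IH) => n [At As] u; rewrite inE => /orP [/eqP -> //|]; exact: As.
Qed.

Definition vanishing (f : {mpoly R[d]}) : Prop := ae (fun n => f.@[x n] = 0).

(** The ultrafilter dichotomy makes the ideal of vanishing polynomials prime. *)
Lemma generic_field : exists (K : fieldType) (iota : {rmorphism {mpoly R[d]} -> K}),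
  (forall p, iota p = 0 <-> vanishing p) /\
  (forall z, exists p q, iota q != 0 /\ z = iota p / iota q).
Proof.
apply: residue_field.
- by apply: ae_true => n; rewrite meval0.
- by move=> p q pI qI; apply: aeS (aeI pI qI) => n [p0 q0]; rewrite mevalB p0 q0 subr0.
- by move=> p q qI; apply: aeS qI => n q0; rewrite mevalM q0 mulr0.
- by move=> /ae_ex [n /eqP]; rewrite meval1 oner_eq0.
- move=> p q pqI; have [pI|pI] := ae_or (fun n => p.@[x n] = 0); first by left.
  right; apply: aeS (aeI pqI pI) => n [/eqP]; rewrite mevalM mulf_eq0.
  by move=> /orP [/eqP p0 []|/eqP].
Qed.

Variables (K : fieldType) (iota : {rmorphism {mpoly R[d]} -> K}).
Hypothesis iota0 : forall p, iota p = 0 <-> vanishing p.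
Hypothesis iota_surj : forall z, exists p q, iota q != 0 /\ z = iota p / iota q.

Definition cst (c : R) : K := iota c%:MP.
HB.instance Definition _ := GRing.RMorphism.copy cst (iota \o (@mpolyC d R)).
Let xi j : K := iota 'X_j.

(** A relation between the values at the points x n passes to every R-linear [lam] killing vanishing
    polynomials, since [lam] only sees the span of the value vectors. *)
Lemma generic_transfer (T : finType) (p : T -> {mpoly R[d]}) (ka : T -> K)
    (lam : {mpoly R[d]} -> K) :
  {morph lam : f g / f + g} -> (forall c f, lam (c *: f) = cst c * lam f) ->
  (forall f, vanishing f -> lam f = 0) ->
  ae (fun n => \sum_t cst (p t).@[x n] * ka t = 0) -> \sum_t lam (p t) * ka t = 0.
Proof.
move=> lamD lamZ lam0 aeA.
set A := (fun n => _) in aeA.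
have lam_sum (S : finType) (F : S -> {mpoly R[d]}) : lam (\sum_s F s) = \sum_s lam (F s).
  elim/big_rec2: _ => [|s y f _ <-]; last exact: lamD.
  by apply: lam0; apply: ae_true => n; rewrite meval0.
pose v (n : {n | A n}) : 'rV[R]_#|T| := \row_i (p (enum_val i)).@[x (sval n)].
have [m [s sP]] := spanning_sample v.
pose M := \matrix_i v (s i); pose Pi := pinvmx M *m M.
(* [Pi] fixes every value vector, so p_j and its transform by [Pi] agree at almost all points. *)
have lamp j : lam (p (enum_val j)) = \sum_i cst (Pi i j) * lam (p (enum_val i)).
  apply/eqP; rewrite -subr_eq0; apply/eqP.
  transitivity (lam (p (enum_val j) + (-1) *: \sum_i Pi i j *: p (enum_val i))).
    rewrite lamD lamZ lam_sum rmorphN1 mulN1r; congr (_ - _).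
    by apply: eq_bigr => i _; rewrite lamZ.
  apply: lam0; apply: aeS aeA => n nA.
  have : v (exist _ n nA) *m Pi = v (exist _ n nA) by rewrite mulmxA mulmxKpV.
  move/rowP/(_ j); rewrite mxE [X in _ = X]mxE /= => vj.
  rewrite mevalD mevalZ raddf_sum mulN1r -vj /=; apply/eqP; rewrite subr_eq0; apply/eqP.
  by apply: eq_bigr => i _; rewrite mevalZ mxE mulrC.
rewrite (reindex (fun i : 'I_#|T| => enum_val i)) /=; last first.
  by apply: onW_bij; exact: enum_val_bij.
transitivity (\sum_i lam (p (enum_val i)) * \sum_j cst (Pi i j) * ka (enum_val j)).
  under eq_bigr do rewrite lamp mulr_suml.
  rewrite exchange_big; apply: eq_bigr => i _ /=; rewrite mulr_sumr.
  by apply: eq_bigr => j _; ring.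
(* The rows of [Pi] combine sampled value vectors, and each of these is orthogonal to [ka]. *)
apply: big1 => i _; rewrite (_ : \sum_j _ = 0) ?mulr0 //.
transitivity (\sum_l cst (pinvmx M i l) * \sum_j cst (M l j) * ka (enum_val j)).
  under [RHS]eq_bigr do rewrite mulr_sumr.
  rewrite [RHS]exchange_big; apply: eq_bigr => j _ /=; rewrite mxE rmorph_sum mulr_suml.
  by apply: eq_bigr => l _; rewrite rmorphM mulrA.
apply: big1 => l _; have lA := svalP (s l); rewrite -[X in _ * X](_ : 0 = _) ?mulr0 //.
rewrite -[LHS]lA (reindex (fun i : 'I_#|T| => enum_val i)) /=; last first.
  by apply: onW_bij; exact: enum_val_bij.
by apply: eq_bigr => j _; rewrite !mxE.
Qed.

Lemma mmap_cst f : (map_mpoly cst f).@[xi] = iota f.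
Proof.
elim/mpolyind: f => [|c m p _ _ IH]; first by rewrite !rmorph0.
rewrite !rmorphD /= IH; congr (_ + _).
rewrite map_mpolyZ map_mpolyX mevalZ mevalX -mul_mpolyC rmorphM; congr (_ * _).
by rewrite mpolyXE_id rmorph_prod; apply: eq_bigr => i _; rewrite rmorphXn.
Qed.

Lemma meval_cst f n : (map_mpoly cst f).@[cst \o x n] = cst f.@[x n].
Proof.
elim/mpolyind: f => [|c m p _ _ IH]; first by rewrite !rmorph0.
rewrite !rmorphD /= IH; congr (_ + _).
rewrite map_mpolyZ map_mpolyX !mevalZ !mevalX rmorphM rmorph_prod; congr (_ * _).
by apply: eq_bigr => i _; rewrite rmorphXn.
Qed.

Lemma mderiv_cst (f : {mpoly R[d]}) j : (map_mpoly cst f)^`M(j) = map_mpoly cst (f^`M(j)).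
Proof.
apply/mpolyP => m; rewrite mcoeff_mderiv !mcoeff_map_mpoly mcoeff_mderiv.
by rewrite raddfMn.
Qed.

(** Transfer applied to the monomials of h, paired with its coefficients in K. *)
Lemma generic_zero (h : {mpoly K[d]}) :
  ae (fun n => h.@[cst \o x n] = 0) -> h.@[xi] = 0.
Proof.
move=> h0; pose T := 'I_(size (msupp h)); pose m (t : T) := nth 0%MM (msupp h) t.
have hE v : h.@[v] = \sum_(t : T) ('X_[m t] : {mpoly K[d]}).@[v] * h@_(m t).
  rewrite mevalE (big_nth 0%MM) big_mkord; apply: eq_bigr => t _.
  by rewrite mulrC mevalX.
rewrite hE; under eq_bigr do rewrite -(map_mpolyX cst) mmap_cst.
apply: (generic_transfer (p := fun t => 'X_[m t]) (lam := iota)).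
- by move=> f g; rewrite rmorphD.
- by move=> c f; rewrite -mul_mpolyC rmorphM.
- by move=> f /iota0.
- apply: aeS h0 => n; rewrite hE; apply: etrans; apply: eq_bigr => t _.
  by rewrite -meval_cst map_mpolyX.
Qed.

Lemma generic_neq n : exists j, cst (x n j) != xi j.
Proof.
apply: contrapT => no; suff [m [mn /mn]] : exists m, m <> n /\ m = n by [].
apply: ae_ex; apply: (aeI (ae_neq n)).
have : ae (fun m => forall j, x m j = x n j).
  apply: ae_forall => j; have : iota ('X_j - (x n j)%:MP) = 0.
    rewrite rmorphB; apply/eqP; rewrite subr_eq0 eq_sym; apply: contrapT => /negP ne.
    by apply: no; exists j.
  by move/iota0; apply: aeS => m /eqP; rewrite mevalB mevalXU mevalC subr_eq0 => /eqP.
by apply: aeS => m xmn; apply: x_inj; apply/funext.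
Qed.

Let grad f : 'rV[K]_d := \row_j iota (f^`M(j)).

(** The matrix of Hadamard quotients at x n kills the nonzero vector x n - xi, so its determinant
    vanishes at almost all x n, hence at xi, where the matrix is the Jacobian. *)
Lemma gradients_dependent (f : 'I_d -> {mpoly R[d]}) :
  (forall i, vanishing (f i)) -> \det (\matrix_i grad (f i)) = 0.
Proof.
move=> f0.
have [Q QE] := choice (fun i => hadamard xi (map_mpoly cst (f i))).
pose q := \det (\matrix_(i, j) Q i j).
have -> : \det (\matrix_i grad (f i)) = q.@[xi].
  rewrite /q -[RHS]det_map_mx; congr (\det _); apply/matrixP => i j; rewrite !mxE.
  by rewrite /= (QE i).2 mderiv_cst mmap_cst.
apply: generic_zero; apply: aeS (ae_forall f0) => n fn0.
rewrite /q -det_map_mx; set A := map_mx _ _.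
have [j jn] := generic_neq n.
pose w : 'cV[K]_d := \col_j (cst (x n j) - xi j).
have Aw : A *m w = 0.
  apply/colP => i; rewrite !mxE.
  have := congr1 (fun g => g.@[cst \o x n]) (QE i).1 => /=.
  rewrite meval_cst fn0 rmorph0 mmap_cst (iota0 _).2; last exact: f0.
  rewrite mpolyC0 add0r raddf_sum /= => /esym H; rewrite -[RHS]H.
  apply: eq_bigr => l _; rewrite !mxE mevalM mevalB mevalXU mevalC.
  by [].
have := congr1 (mulmx (\adj A)) Aw; rewrite mulmxA mul_adj_mx mulmx0 mul_scalar_mx.
move/colP/(_ j); rewrite !mxE => /eqP; rewrite mulf_eq0 subr_eq0 (negbTE jn) orbF.
by move/eqP.
Qed.

(** The gradients of vanishing polynomials do not span K^d, so some nonzero vector is orthogonal to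
    all of them. *)
Lemma tangent_vector : exists2 a : 'I_d -> K, exists j, a j != 0 &
  forall f, vanishing f -> \sum_j a j * iota (f^`M(j)) = 0.
Proof.
have [m [s sP]] := spanning_sample (fun f : {f | vanishing f} => grad (sval f)).
pose M := \matrix_i grad (sval (s i)).
have rM : (\rank M < d)%N.
  rewrite ltn_neqAle rank_leq_col andbT; apply/negP => rMd.
  have fM : row_full M by [].
  have := gradients_dependent (fun i => svalP (s (fullrankfun fM i))).
  have -> : \matrix_i grad (sval (s (fullrankfun fM i))) = rowsub (fullrankfun fM) M.
    by apply/row_matrixP => i; rewrite rowK row_rowsub rowK.
  apply/eqP; rewrite -unitfE -unitmxE -row_full_unit; exact: fullrowsub_full.
have : kermx M^T != 0.
  by rewrite kermx_eq0 /row_free mxrank_tr neq_ltn rM.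
case/rowV0Pn => v /sub_kermxP vM v0.
exists (fun j => v 0 j).
  apply: contrapT => no; case/eqP: v0; apply/rowP => j; rewrite mxE.
  by apply/eqP; apply: contrapT => /negP ne; apply: no; exists j.
move=> f f0; have /submxP [c cE] := sP (exist _ f f0).
have : v *m (grad f)^T = 0 by rewrite cE trmx_mul mulmxA vM mul0mx.
move/matrixP/(_ 0 0); rewrite [LHS]mxE [RHS]mxE => H; rewrite -[RHS]H.
by apply: eq_bigr => j _; rewrite !mxE.
Qed.

(** Denominators are cleared; the sum of squares then vanishes at almost all x n, where its terms
    are nonnegative. *)
Lemma generic_real (T : finType) (z : T -> K) :
  \sum_t z t ^+ 2 = 0 -> forall t, z t = 0.
Proof.
move=> z0; have [p pP] := choice (fun t => iota_surj (z t)).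
have [q qP] := choice pP.
pose r t := p t * \prod_(s | s != t) q s.
pose Q := iota (\prod_t q t).
have Q0 : Q != 0 by rewrite /Q rmorph_prod; apply/prodf_neq0 => t _; have [] := qP t.
have rE t : iota (r t) = z t * Q.
  have qE : \prod_t q t = q t * \prod_(s | s != t) q s by rewrite (bigD1 t).
  by have [qt ->] := qP t; rewrite /Q /r qE !rmorphM mulrA divfK.
have : iota (\sum_t r t ^+ 2) = 0.
  rewrite rmorph_sum; under eq_bigr do rewrite rmorphXn rE exprMn.
  by rewrite -mulr_suml z0 mul0r.
move/iota0 => sq0 t; apply: (mulIf Q0); rewrite mul0r -rE; apply/iota0.
apply: aeS sq0 => n; rewrite raddf_sum => /eqP.
rewrite psumr_eq0 => [/allP /(_ t) /=|s _] /=; last by rewrite expr2 mevalM -expr2 sqr_ge0.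
by rewrite mem_index_enum expr2 mevalM -expr2 sqrf_eq0 => /(_ isT) /eqP.
Qed.

(** * The derivation along a tangent vector *)

Section Derivation.
Variable a : 'I_d -> K.
Hypothesis a_tangent : forall f, vanishing f -> \sum_j a j * iota (f^`M(j)) = 0.

Definition poly_deriv (f : {mpoly R[d]}) : K := \sum_j a j * iota (f^`M(j)).

Lemma poly_derivD f g : poly_deriv (f + g) = poly_deriv f + poly_deriv g.
Proof.
rewrite /poly_deriv -big_split; apply: eq_bigr => j _ /=.
by rewrite mderivD rmorphD mulrDr.
Qed.
Lemma poly_derivZ c f : poly_deriv (c *: f) = cst c * poly_deriv f.
Proof.
rewrite /poly_deriv mulr_sumr; apply: eq_bigr => j _ /=.
by rewrite mderivZ -mul_mpolyC rmorphM mulrCA.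
Qed.
Lemma poly_derivM f g : poly_deriv (f * g) = poly_deriv f * iota g + iota f * poly_deriv g.
Proof.
rewrite /poly_deriv mulr_suml mulr_sumr -big_split; apply: eq_bigr => j _ /=.
by rewrite mderivM rmorphD !rmorphM; ring.
Qed.
Lemma poly_derivB f g : poly_deriv (f - g) = poly_deriv f - poly_deriv g.
Proof. by rewrite -scaleN1r poly_derivD poly_derivZ rmorphN1 mulN1r. Qed.

Definition numer z := projT1 (cid (iota_surj z)).
Definition denom z := projT1 (cid (projT2 (cid (iota_surj z)))).
Lemma denomP z : iota (denom z) != 0 /\ z = iota (numer z) / iota (denom z).
Proof. exact: projT2 (cid (projT2 (cid (iota_surj z)))). Qed.

Definition generic_deriv (z : K) : K :=
  (poly_deriv (numer z) * iota (denom z) - iota (numer z) * poly_deriv (denom z))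
    / iota (denom z) ^+ 2.

(** Independence of the chosen fraction: for equal fractions n q - p e vanishes, and tangency makes
    [poly_deriv] kill it. *)
Lemma generic_derivE p q : iota q != 0 -> generic_deriv (iota p / iota q) =
  (poly_deriv p * iota q - iota p * poly_deriv q) / iota q ^+ 2.
Proof.
move=> q0; rewrite /generic_deriv; have [] := denomP (iota p / iota q).
move: (numer _) (denom _) => n e e0 zE.
have neE : iota n * iota q = iota p * iota e.
  by apply: (mulIf (invr_neq0 e0)); rewrite mulfK // mulrAC -zE divfK.
have : poly_deriv (n * q - p * e) = 0.
  by apply: a_tangent; apply/iota0; rewrite rmorphB !rmorphM neE subrr.
rewrite poly_derivB !poly_derivM => /eqP; rewrite subr_eq0 => /eqP DE.
apply/eqP; rewrite eqr_div ?expf_neq0 //; apply/eqP.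
move: (poly_deriv n) (poly_deriv q) (poly_deriv p) (poly_deriv e) DE => Dn Dq Dp De DE.
move: (iota n) (iota q) (iota p) (iota e) q0 e0 neE DE {zE} => N Q P E Q0 E0 NE DE.
have DnE : Dn = (Dp * E + P * De - N * Dq) / Q by rewrite -DE; field.
have NE' : N = P * E / Q by rewrite -NE; field.
by rewrite DnE NE'; field.
Qed.

Lemma generic_deriv_iota p : generic_deriv (iota p) = poly_deriv p.
Proof.
have D1 : poly_deriv 1 = 0.
  by rewrite -mpolyC1 /poly_deriv big1 // => j _; rewrite mderivC rmorph0 mulr0.
have := @generic_derivE p 1; rewrite rmorph1 divr1 => -> //; last exact: oner_neq0.
by rewrite expr1n divr1 mulr1 D1 mulr0 subr0.
Qed.

Lemma generic_derivD : {morph generic_deriv : y z / y + z}.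
Proof.
move=> y z; have [p [q [q0 ->]]] := iota_surj y; have [r [s [s0 ->]]] := iota_surj z.
have -> : iota p / iota q + iota r / iota s = iota (p * s + r * q) / iota (q * s).
  by rewrite rmorphD !rmorphM; field; rewrite s0 q0.
rewrite !generic_derivE // ?rmorphM ?mulf_neq0 // poly_derivD !poly_derivM rmorphD !rmorphM.
by field; rewrite s0 q0.
Qed.
Lemma generic_derivM y z :
  generic_deriv (y * z) = generic_deriv y * z + y * generic_deriv z.
Proof.
have [p [q [q0 ->]]] := iota_surj y; have [r [s [s0 ->]]] := iota_surj z.
have -> : iota p / iota q * (iota r / iota s) = iota (p * r) / iota (q * s).
  by rewrite !rmorphM; field; rewrite s0 q0.
rewrite !generic_derivE // ?rmorphM ?mulf_neq0 // !poly_derivM ?rmorphM.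
by field; rewrite s0 q0.
Qed.
Lemma generic_deriv_cst c : generic_deriv (cst c) = 0.
Proof.
rewrite generic_deriv_iota /poly_deriv big1 // => j _.
by rewrite mderivC rmorph0 mulr0.
Qed.
Lemma generic_deriv_xi j : generic_deriv (xi j) = a j.
Proof.
rewrite generic_deriv_iota /poly_deriv (bigD1 j) //= big1 => [|i ij].
  rewrite mderivX mnmE eqxx scale1r.
  have -> : (U_(j) - U_(j) = 0 :> 'X_{1..d})%MM by apply/mnmP => k; rewrite mnmBE subnn mnm0E.
  by rewrite mpolyX0 rmorph1 mulr1 addr0.
by rewrite mderivX mnmE eq_sym (negbTE ij) scale0r rmorph0 mulr0.
Qed.
End Derivation.
End GenericPoint.

(** The identity between pairs of real points is carried, one variable at a time, to the Taylor
    expansion and the constant value at the generic point. *)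
Theorem gram_power_rigidity (R : rcfType) (d a b r : nat) (x : nat -> 'I_d -> R)
    (Phi : 'I_r -> {mpoly R[d]}) (o : nat) (ae : (nat -> Prop) -> Prop) :
  (forall A B : nat -> Prop, (forall n, A n -> B n) -> ae A -> ae B) ->
  (forall A B, ae A -> ae B -> ae (fun n => A n /\ B n)) ->
  (forall A, ae A \/ ae (fun n => ~ A n)) ->
  (forall A, ae A -> exists n, A n) ->
  (forall m, ae (fun n => n <> m)) ->
  injective x -> (0 < a)%N -> coprime a b -> (d <= b)%N ->
  (forall n, \sum_i x o i * x n i = 1) ->
  (forall m n, (\sum_k (Phi k).@[x m] * (Phi k).@[x n]) ^+ b =
    (\sum_i x m i * x n i) ^+ a) -> False.
Proof.
move=> aeS aeI ae_or ae_ex ae_neq x_inj a0 co db xo PhiE.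
have [K [iota [iota0 iota_surj]]] := generic_field x aeS aeI ae_or ae_ex.
have ae_all := ae_true ae_or ae_ex.
have [t [j tj] t_tangent] := tangent_vector aeS aeI ae_or ae_ex ae_neq x_inj iota0.
pose D := generic_deriv iota_surj t.
have DD : {morph D : y z / y + z} := generic_derivD iota0 iota_surj t_tangent.
have DM : forall y z, D (y * z) = D y * z + y * D z :=
  generic_derivM iota0 iota_surj t_tangent.
have Dcst c : D (cst iota c) = 0 := generic_deriv_cst iota0 iota_surj t_tangent c.
have realK := generic_real aeS iota0 iota_surj.
apply: (taylor_rigidity DD DM realK (xi := fun i => iota 'X_i)
  (s := fun i => cst iota (x o i)) (phi := fun k => iota (Phi k)) a0 co db) => //; last first.
- by exists j; have := generic_deriv_xi iota0 iota_surj t_tangent j; rewrite /= -/D => ->.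
- transitivity (iota (\sum_i x o i *: 'X_i)).
    by rewrite rmorph_sum; apply: eq_bigr => k _; rewrite -mul_mpolyC rmorphM.
  apply/eqP; rewrite -subr_eq0 -(rmorph1 iota) -rmorphB; apply/eqP/iota0.
  apply: (ae_all) => n; rewrite mevalB meval1 raddf_sum -[X in _ - X](xo n).
  apply/eqP; rewrite subr_eq0; apply/eqP; apply: eq_bigr => k _.
  by rewrite /= mevalZ mevalXU.
have expand n (T : finType) (p : T -> {mpoly R[d]}) :
    (\sum_t taylor D (iota (p t)) * psC (iota (p t))) ^+ n =
    \sum_(I : {ffun 'I_n -> T}) taylor D (iota (\prod_l p (I l)))
      * psC (iota (\prod_l p (I l))).
  rewrite -[in LHS](card_ord n) -prodr_const bigA_distr_bigA /=; apply: eq_bigr => I _.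
  by rewrite big_split /= !rmorph_prod (taylor_prod DD DM realK).
have mexpand n m l (T : finType) (p : T -> {mpoly R[d]}) :
    (\sum_t (p t).@[x m] * (p t).@[x l]) ^+ n =
    \sum_(I : {ffun 'I_n -> T}) (\prod_h p (I h)).@[x m] * (\prod_h p (I h)).@[x l].
  rewrite -[in LHS](card_ord n) -prodr_const bigA_distr_bigA /=; apply: eq_bigr => I _.
  by rewrite big_split /= !rmorph_prod.
rewrite !expand; apply/pseriesP => n; apply/eqP; rewrite -subr_eq0; apply/eqP.
(* One index type for the monomials of both sides, with the sign carried by [ka]. *)
pose T := ({ffun 'I_b -> 'I_r} + {ffun 'I_a -> 'I_d})%type.
pose p (u : T) := match u with inl f => \prod_l Phi (f l) | inr h => \prod_l 'X_(h l) end.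
pose ka (u : T) := match u with inl _ => iota (p u) | inr _ => - iota (p u) end.
have bigT (V : nmodType) (F : T -> V) : \sum_u F u = \sum_I F (inl I) + \sum_I F (inr I).
  exact: big_sumType.
transitivity (\sum_u taylor D (iota (p u)) n * ka u).
  rewrite bigT !ps_sum -sumrN; congr (_ + _); apply: eq_bigr => I _.
    by rewrite mulrC psCM mulrC.
  by rewrite mulrC psCM mulrC mulrN.
apply: (generic_transfer aeS ae_or ae_ex (lam := fun f => taylor D (iota f) n)).
- by move=> f g; rewrite rmorphD taylorD.
- move=> c f; rewrite -mul_mpolyC rmorphM (taylorM DD DM realK) (taylor_const DD (Dcst c)).
  by rewrite psCM.
- by move=> f /iota0 ->; rewrite (taylor0 DD) ps0.
apply: (ae_all) => m.
transitivity (iota (\sum_u (p u).@[x m] *: (match u with inl _ => p u | inr _ => - p u end))).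
  rewrite rmorph_sum; apply: eq_bigr => -[I|I] _; rewrite -mul_mpolyC rmorphM //.
  by rewrite rmorphN.
(* The first variable is now the real point x m; for the second, vanishing at all x l suffices. *)
apply/iota0; apply: (ae_all) => l; rewrite raddf_sum bigT.
have := PhiE m l; have mx : forall i, x m i = ('X_i : {mpoly R[d]}).@[x m] by move=> i; rewrite mevalXU.
have -> : \sum_i x m i * x l i = \sum_i ('X_i : {mpoly R[d]}).@[x m] * ('X_i : {mpoly R[d]}).@[x l].
  by apply: eq_bigr => i _; rewrite !mevalXU.
rewrite !mexpand => /eqP; rewrite -subr_eq0 => /eqP H; rewrite -[RHS]H -sumrN.
congr (_ + _); apply: eq_bigr => I _ /=; rewrite mevalZ //.
by rewrite mevalN mulrN.
Qed.

Theorem no_power_kernel (R : rcfType) (d a b : nat) (x : nat -> 'I_d -> R)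
    (g : nat -> nat -> R) (o : nat) (ae : (nat -> Prop) -> Prop) :
  (forall A B : nat -> Prop, (forall n, A n -> B n) -> ae A -> ae B) ->
  (forall A B, ae A -> ae B -> ae (fun n => A n /\ B n)) ->
  (forall A, ae A \/ ae (fun n => ~ A n)) ->
  (forall A, ae A -> exists n, A n) ->
  (forall m, ae (fun n => n <> m)) ->
  injective x -> (0 < a)%N -> coprime a b -> (d <= b)%N ->
  (forall n, \sum_i x o i * x n i = 1) ->
  positive_kernel g -> (forall n, g n o = 1) ->
  (forall m n, g m n ^+ b = (\sum_i x m i * x n i) ^+ a) -> False.
Proof.
move=> aeS aeI ae_or ae_ex ae_neq x_inj a0 co db xo gP go gE.
have b0 : (0 < b)%N.
  rewrite (leq_trans _ db) // lt0n; apply/eqP => d0; have := xo o.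
  rewrite big1 => [/esym /eqP|i _]; first by rewrite oner_eq0.
  by have := ltn_ord i; rewrite [X in (_ < X)%N]d0.
have [r [Th ThE]] := power_of_gram_is_gram b0 gP go gE.
pose Phi k : {mpoly R[d]} := \sum_(J : {ffun 'I_a -> 'I_d}) Th J k *: \prod_j 'X_(J j).
apply: (gram_power_rigidity (Phi := Phi) aeS aeI ae_or ae_ex ae_neq x_inj a0 co db xo).
have PhiE n k : (Phi k).@[x n] = \sum_J Th J k * \prod_j x n (J j).
  rewrite raddf_sum; apply: eq_bigr => J _; rewrite /= mevalZ rmorph_prod /=.
  by congr (_ * _); apply: eq_bigr => j _; rewrite mevalXU.
move=> m n; rewrite -gE ThE; congr (_ ^+ _); apply: eq_bigr => k _.
by rewrite !PhiE.
Qed.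
End GenericPoint.

(** * Minimizers and positivity on the support *)

From mathcomp Require Import all_classical all_reals all_analysis measurable_realfun.
Import numFieldNormedType.Exports.
Local Open Scope classical_set_scope.
Local Open Scope ring_scope.

(* Perturb the weights 1 to (1 + e v) / (1 + e c) with e of both signs. *)
Lemma quad_ge0_of_min (R : rcfType) (F : finType) (m : F -> R) (k : F -> F -> R) (v : F -> R) :
  (forall B, 0 <= m B) -> \sum_B m B = 1 -> (forall B C, 0 <= k B C) ->
  (forall w : F -> R, (forall B, 0 <= w B) -> \sum_B w B * m B = 1 ->
     quad k (fun=> 1) <= quad k w) ->
  0 <= quad k v.
Proof.
move=> m0 m1 k0 kmin.
have [c cE] : exists c, c = \sum_B v B * m B by exists (\sum_B v B * m B).
(* With |e| = 1 / S, the perturbed weights and the total mass 1 + e c stay positive. *)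
pose S := 1 + `|c| + \sum_B `|v B|.
have sv0 : 0 <= \sum_B `|v B| by apply: sumr_ge0.
have S0 : 0 < S by rewrite /S; have := normr_ge0 c; lra.
pose I0 := quad k (fun=> 1); pose L := \sum_B \sum_C (v B + v C) * k B C.
have I00 : 0 <= I0 by apply: sumr_ge0 => B _; apply: sumr_ge0 => C _; rewrite !mul1r.
have key e : `|e| = S^-1 -> I0 * (1 + e * c) ^+ 2 <= I0 + e * L + e ^+ 2 * quad k v.
  move=> eS; have bnd y : `|y| < S -> 0 < 1 + e * y.
    move=> yS; have : `|e * y| < 1.
      by rewrite normrM eS -[ltRHS](mulVf (lt0r_neq0 S0)) ltr_pM2l ?invr_gt0.
    by rewrite ltr_norml; lra.
  have c0 : 0 < 1 + e * c by apply: bnd; rewrite /S; lra.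
  have := kmin (fun B => (1 + e * v B) / (1 + e * c)).
  have -> : quad k (fun B => (1 + e * v B) / (1 + e * c)) =
      (I0 + e * L + e ^+ 2 * quad k v) / (1 + e * c) ^+ 2.
    rewrite /I0 /L /quad !mulr_sumr -!big_split mulr_suml; apply: eq_bigr => B _ /=.
    rewrite !mulr_sumr -!big_split mulr_suml; apply: eq_bigr => C _ /=.
    by field; exact: lt0r_neq0.
  rewrite ler_pdivlMr ?exprn_gt0 //; apply.
    move=> B; rewrite divr_ge0 ?ltW //; apply: bnd; rewrite /S (bigD1 B) //=.
    have : 0 <= \sum_(i | i != B) `|v i| by apply: sumr_ge0.
    by have := normr_ge0 c; lra.
  under eq_bigr do rewrite mulrAC mulrDl mul1r -mulrA.
  by rewrite -mulr_suml big_split /= m1 -mulr_sumr -cE divff ?lt0r_neq0.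
have H1 : I0 * (1 + S^-1 * c) ^+ 2 <= I0 + S^-1 * L + S^-1 ^+ 2 * quad k v.
  by apply: key; rewrite ger0_norm // invr_ge0 ltW.
have H2 : I0 * (1 - S^-1 * c) ^+ 2 <= I0 - S^-1 * L + S^-1 ^+ 2 * quad k v.
  have := key (- S^-1); rewrite !mulNr sqrrN; apply.
  by rewrite normrN ger0_norm // invr_ge0 ltW.
(* The mean of the inequalities for e and - e, in which the linear term [L] cancels. *)
have H3 : S^-1 ^+ 2 * (I0 * c ^+ 2) <= S^-1 ^+ 2 * quad k v.
  have -> : S^-1 ^+ 2 * (I0 * c ^+ 2) =
    (I0 * (1 + S^-1 * c) ^+ 2 + I0 * (1 - S^-1 * c) ^+ 2) / 2 - I0 by field; exact: lt0r_neq0.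
  lra.
rewrite ler_pM2l ?exprn_gt0 ?invr_gt0 // in H3.
by apply: le_trans H3; rewrite mulr_ge0 ?sqr_ge0.
Qed.

(** * Reweighting a probability along a finite partition *)

Section Reweighting.
Context d (X : measurableType d) (R : realType) (mu : probability X R).
Variables (F : finType) (tau : X -> F).
Hypothesis mtau : forall B, measurable (tau @^-1` [set B]).
Let A B := tau @^-1` [set B].
Let mA B : measurable (A B). Proof. exact: mtau. Qed.

Lemma trivIset_atoms (D : set F) : trivIset D A.
Proof. by move=> B C _ _ [x [/= <- <-]]. Qed.

Lemma bigcup_atoms : \big[setU/set0]_(B : F) A B = [set: X].
Proof.
apply/seteqP; split=> // x _; rewrite -bigcup_seq_cond; exists (tau x) => //.
by rewrite /= mem_index_enum.
Qed.

Lemma integral_atoms (nu : {measure set X -> \bar R}) (f : X -> \bar R) :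
  measurable_fun [set: X] f -> (forall x, (0 <= f x)%E) ->
  (\int[nu]_x f x = \sum_(B : F) \int[nu]_(x in A B) f x)%E.
Proof.
move=> mf f0; rewrite -[in LHS]bigcup_atoms ge0_integral_bigsetU //.
- exact: index_enum_uniq.
- exact: trivIset_atoms.
- by rewrite bigcup_atoms.
Qed.

Lemma measure_atoms (D : pred F) :
  mu [set x | D (tau x)] = (\sum_(B | D B) mu (A B))%E.
Proof.
have mD : measurable [set x | D (tau x)].
  rewrite (_ : [set x | D (tau x)] = \big[setU/set0]_(B | D B) A B).
    by apply: bigsetU_measurable => B _; exact: mtau.
  rewrite -bigcup_seq_cond; apply/seteqP; split=> x /=.
    by move=> Dx; exists (tau x) => //=; rewrite mem_index_enum.
  by move=> [B /= /andP[_ DB] ->].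
rewrite -[X in mu X]setIT -integral_indic // integral_atoms; first last.
- by move=> x; rewrite lee_fin.
- by apply: measurableT_comp => //; exact: measurable_indic.
rewrite [RHS]big_mkcond; apply: eq_bigr => B _; rewrite integral_indic //.
case: ifP => DB; first by rewrite setIidr // => x /= ->.
rewrite (_ : _ `&` _ = set0) ?measure0 //.
by apply/seteqP; split=> // x [/= + xB]; rewrite xB DB.
Qed.

Lemma sum_mu_atoms : \sum_(B : F) fine (mu (A B)) = 1.
Proof.
rewrite sum_fine => [|B _]; last exact: fin_num_measure.
rewrite -(measure_atoms predT) -[1]/(fine 1%E); congr fine.
by rewrite -[RHS](@probability_setT _ _ _ mu); congr (mu _); apply/seteqP.
Qed.

Lemma reweighting (w : F -> R) : (forall B, 0 <= w B) ->
  \sum_B w B * fine (mu (A B)) = 1 ->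
  exists nu : probability X R, forall f : X -> \bar R,
    measurable_fun [set: X] f -> (forall x, (0 <= f x)%E) ->
    (\int[nu]_x f x = \sum_B (w B)%:E * \int[mu]_(x in A B) f x)%E.
Proof.
move=> w0 w1.
pose wn B : {nonneg R} := NngNum (w0 B).
pose m_ B : {measure set X -> \bar R} := mscale (wn B) (mrestr mu (mtau B)).
pose s := enum F; pose B0 := tau point.
(* [msum] takes a sequence of measures, hence the enumeration of F; the default [B0] is never
   reached. *)
pose nu0 : {measure set X -> \bar R} := msum (fun n => m_ (nth B0 s n)) #|F|.
have nu0E Y : nu0 Y = (\sum_B (w B)%:E * mu (Y `&` A B))%E.
  rewrite -[RHS]big_enum -/s [RHS](big_nth B0) [RHS]big_mkord.
  by rewrite /nu0 /= /msum cardE.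
have nu01 : nu0 setT = 1%E.
  rewrite nu0E -[1%E]/(1%:E) -w1 -sumEFin; apply: eq_bigr => B _.
  by rewrite setTI EFinM fineK // fin_num_measure.
pose nu1 := Measure_isProbability.Build _ _ _ nu0 nu01.
pose nu : probability X R := HB.pack (Measure.sort nu0) nu1.
exists nu => f mf f0.
rewrite integral_atoms //; apply: eq_bigr => B _.
transitivity (\int[mscale (wn B) mu]_(x in A B) f x)%E.
  apply: eq_measure_integral => Y mY YB.
  rewrite -[LHS]/(nu0 Y) nu0E (bigD1 B) //= big1 => [|C CB].
    by rewrite adde0 setIidl.
  rewrite (_ : Y `&` A C = set0) ?measure0 ?mule0 //.
  apply/seteqP; split=> // x [/YB /= xB /= xC]; move: CB.
  by rewrite -xC -xB eqxx.
rewrite ge0_integral_mscale //; exact: measurable_funTS.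
Qed.
End Reweighting.

(** Each s is replaced by m restricted to the atoms selected by [inc s] and normalized by the mass
    [M s]; the form of k there exceeds that of q by at most the error term. *)
Lemma quad_approx (R : rcfType) (F S : finType) (inc : S -> pred F) (m : F -> R)
    (k : F -> F -> R) (q : S -> S -> R) (delta : R) (c : S -> R) :
  (forall B, 0 <= m B) -> (forall s, 0 < \sum_(B | inc s B) m B) ->
  (forall s t B C, inc s B -> inc t C ->
     `|k B C - q s t * (m B * m C)| <= delta * (m B * m C)) ->
  (forall v, 0 <= quad k v) ->
  0 <= quad q c + delta * (\sum_s `|c s|) ^+ 2.
Proof.
move=> m0; set M := fun s => \sum_(B | inc s B) m B => M0 close k0.
pose b s B := (inc s B)%:R / M s.
have b1 s : \sum_B b s B * m B = 1.
  rewrite -[RHS](mulVf (lt0r_neq0 (M0 s))) [X in _ * X]big_mkcond mulr_sumr.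
  apply: eq_bigr => B _ /=; rewrite /b; case: ifP => _; last by rewrite !mul0r mulr0.
  by rewrite mul1r.
apply: le_trans (k0 (fun B => \sum_s c s * b s B)) _.
pose e s t := c s * c t * q s t + delta * (`|c s| * `|c t|).
have -> : quad q c + delta * (\sum_s `|c s|) ^+ 2 =
    \sum_B \sum_C \sum_s \sum_t (b s B * m B) * (b t C * m C) * e s t.
  have -> : quad q c + delta * (\sum_s `|c s|) ^+ 2 = \sum_s \sum_t e s t.
    rewrite /quad expr2 mulr_suml mulr_sumr -big_split; apply: eq_bigr => s _ /=.
    by rewrite !mulr_sumr -big_split.
  transitivity (\sum_s \sum_t \sum_B \sum_C (b s B * m B) * (b t C * m C) * e s t).
    apply: eq_bigr => s _; apply: eq_bigr => t _.
    transitivity ((\sum_B b s B * m B) * (\sum_C b t C * m C) * e s t).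
      by rewrite !b1 !mul1r.
    rewrite !mulr_suml; apply: eq_bigr => B _.
    by rewrite mulr_sumr mulr_suml.
  under eq_bigr do rewrite exchange_big /=.
  rewrite exchange_big; apply: eq_bigr => B _ /=.
  under eq_bigr do rewrite exchange_big /=.
  by rewrite exchange_big.
apply: ler_sum => B _; apply: ler_sum => C _.
rewrite -mulrA mulr_suml; apply: ler_sum => s _.
rewrite mulrCA mulr_suml; apply: ler_sum => t _.
rewrite /e /b; case sB: (inc s B); last by rewrite !(mul0r, mulr0).
case tC: (inc t C); last by rewrite !(mul0r, mulr0).
have {}close := close s t B C sB tC.
rewrite !mul1r; have Ms := M0 s; have Mt := M0 t.
have MM : 0 <= (M s)^-1 * (M t)^-1 by rewrite mulr_ge0 ?invr_ge0 ?ltW.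
have H : c s * c t * (k B C - q s t * (m B * m C)) <= `|c s| * `|c t| * (delta * (m B * m C)).
  apply: le_trans (ler_norm _) _; rewrite !normrM ler_wpM2l ?mulr_ge0 //.
by have := ler_wpM2l MM H; lra.
Qed.

(** * Energy of a kernel between blocks of a partition *)

Section KernelEnergy.
Context d (X : measurableType d) (R : realType) (K : X -> X -> R).
Hypothesis K0 : forall x y, 0 <= K x y.
Hypothesis mK : measurable_fun [set: X * X] (fun z => K z.1 z.2).

Definition block_energy (mu : probability X R) (B C : set X) : \bar R :=
  (\int[mu]_(x in B) \int[mu]_(y in C) (K x y)%:E)%E.

Lemma measurable_row (x : X) : measurable_fun [set: X] (fun y => (K x y)%:E).
Proof. by apply/measurable_EFinP; exact: measurable_fun_pair2 mK. Qed.

Lemma measurable_row_integral (mu : probability X R) (C : set X) : measurable C ->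
  measurable_fun [set: X] (fun x => \int[mu]_(y in C) (K x y)%:E)%E.
Proof.
move=> mC; pose f : X * X -> \bar R := (fun z => (K z.1 z.2)%:E) \_ ([set: X] `*` C).
have mf : measurable_fun setT f.
  have mXC : measurable ([set: X] `*` C) by exact: measurableX measurableT mC.
  apply/(measurable_restrictT _ mXC).
  by apply: measurable_funTS; apply/measurable_EFinP.
have f0 z : (0 <= f z)%E by rewrite /f /patch; case: ifP => // _; rewrite lee_fin.
have := measurable_fun_fubini_tonelli_F (m2 := mu) f mf f0.
congr measurable_fun; apply/funext => x; rewrite integral_mkcond /fubini_F.
apply: eq_integral => y _; rewrite /f /patch.
suff -> : ((x, y) \in [set: X] `*` C) = (y \in C) by [].
by apply/idP/idP; rewrite !inE /=; [case | split].
Qed.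

Lemma row_integral_ge0 (mu : probability X R) (C : set X) x :
  (0 <= \int[mu]_(y in C) (K x y)%:E)%E.
Proof. by apply: integral_ge0 => y _; rewrite lee_fin. Qed.

Lemma block_energy_bounds (mu : probability X R) (B C : set X) (a b : R) :
  measurable B -> measurable C -> 0 <= a ->
  (forall x y, B x -> C y -> a <= K x y <= b) ->
  ((a%:E * (mu C) * mu B <= block_energy mu B C) /\
  (block_energy mu B C <= b%:E * (mu C) * mu B))%E.
Proof.
move=> mB mC a0 Kab; have mrow := measurable_row_integral mu mC.
have rowC x (D : set X) : measurable_fun D (fun y => (K x y)%:E).
  by apply: measurable_funTS; exact: measurable_row.
split; rewrite -integral_cst //; apply: ge0_le_integral => //.
- by move=> x _; rewrite mule_ge0.
- exact: measurable_funTS.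
- move=> x Bx; rewrite -integral_cst //; apply: ge0_le_integral => //.
  by move=> y Cy; rewrite lee_fin; have /andP[] := Kab x y Bx Cy.
- by move=> x _; exact: row_integral_ge0.
- exact: measurable_funTS.
- move=> x Bx; rewrite -integral_cst //; apply: ge0_le_integral => //.
    by move=> y _; rewrite lee_fin.
  by move=> y Cy; rewrite lee_fin; have /andP[] := Kab x y Bx Cy.
Qed.

Lemma block_energy_fin (mu : probability X R) (B C : set X) : (forall x y, K x y <= 1) ->
  measurable B -> measurable C -> block_energy mu B C \is a fin_num.
Proof.
move=> K1 mB mC.
have [|lb ub] := @block_energy_bounds mu B C 0 1 mB mC (lexx _).
  by move=> x y _ _; rewrite K0 K1.
rewrite ge0_fin_numE; last by rewrite !mul0e in lb.
by apply: le_lt_trans ub _; rewrite mul1e ltey_eq fin_numM // fin_num_measure.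
Qed.

Section Minimizer.
Variables (mu : probability X R) (F : finType) (tau : X -> F).
Hypothesis K1 : forall x y, K x y <= 1.
Hypothesis mtau : forall B, measurable (tau @^-1` [set B]).
Hypothesis mu_min : forall nu, (block_energy mu setT setT <= block_energy nu setT setT)%E.

Let A B := tau @^-1` [set B].
Let mA B : measurable (A B). Proof. exact: mtau. Qed.
Let k B C := fine (block_energy mu (A B) (A C)).

Lemma energy_reweighting (nu : probability X R) (w : F -> R) : (forall B, 0 <= w B) ->
  (forall f : X -> \bar R, measurable_fun [set: X] f -> (forall x, (0 <= f x)%E) ->
    (\int[nu]_x f x = \sum_B (w B)%:E * \int[mu]_(x in A B) f x)%E) ->
  block_energy nu setT setT = (quad k w)%:E.
Proof.
move=> w0 nuE; rewrite /block_energy nuE.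
- rewrite /quad -sumEFin; apply: eq_bigr => B _.
  transitivity (((w B)%:E * \sum_C (w C)%:E * block_energy mu (A B) (A C))%E).
    congr (_ * _)%E.
    rewrite (eq_integral (fun x => \sum_C (w C)%:E * \int[mu]_(y in A C) (K x y)%:E)%E); last first.
      by move=> x _; apply: nuE; [exact: measurable_row | move=> y; rewrite lee_fin].
    rewrite ge0_integral_sum //.
    + apply: eq_bigr => C _; rewrite ge0_integralZl ?lee_fin //.
      * by apply: measurable_funTS; exact: measurable_row_integral.
      * by move=> x _; exact: row_integral_ge0.
    + move=> C; apply: measurable_funTS; apply: measurable_funeM.
      exact: measurable_row_integral.
    + by move=> C x _; rewrite mule_ge0 ?lee_fin ?row_integral_ge0.
  rewrite -sumEFin ge0_sume_distrr => [|C _].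
    apply: eq_bigr => C _; rewrite !EFinM muleA fineK //.
    exact: block_energy_fin.
  by rewrite mule_ge0 ?lee_fin //; apply: integral_ge0 => x _; exact: row_integral_ge0.
- exact: measurable_row_integral.
- by move=> x; exact: row_integral_ge0.
Qed.

Lemma minimizer_quad_ge0 (v : F -> R) : 0 <= quad k v.
Proof.
apply: (@quad_ge0_of_min _ _ (fun B => fine (mu (A B)))).
- by move=> B; exact: fine_ge0.
- exact: sum_mu_atoms.
- move=> B C; apply: fine_ge0; apply: integral_ge0 => x _; exact: row_integral_ge0.
- move=> w w0 w1; have [nu nuE] := reweighting mtau w0 w1.
  have := mu_min nu; rewrite (energy_reweighting w0 nuE) (@energy_reweighting mu (fun=> 1)) //.
  move=> f mf f0; rewrite (integral_atoms mtau) //; apply: eq_bigr => B _.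
  by rewrite mul1e.
Qed.
End Minimizer.
End KernelEnergy.

(** * Positivity of the kernel on the support of a minimizer *)

Section SupportPositivity.
Variables (R : realType) (T : ptopologicalType) (K : T -> T -> R).
Hypothesis K0 : forall x y, 0 <= K x y.
Hypothesis K1 : forall x y, K x y <= 1.
Hypothesis mK : measurable_fun [set: borelType T * borelType T] (fun z => K z.1 z.2).
Hypothesis Kcont : forall x y (e : R), 0 < e -> exists U V : set T, [/\ nbhs x U, nbhs y V &
  forall x' y', U x' -> V y' -> `|K x' y' - K x y| <= e].
Variable mu : borel_probability T R.
Hypothesis mu_min : forall nu : borel_probability T R,
  (@block_energy _ (borelType T) R K mu setT setT <= @block_energy _ (borelType T) R K nu setT setT)%E.

(** Small neighbourhoods of the points q s have positive mass, and the kernel is nearly constant on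
    their products. *)
Lemma support_quad_ge0_approx (S : finType) (q : S -> T) (c : S -> R) (e : R) :
  (forall s, measure_support mu (q s)) -> 0 < e ->
  0 <= quad (fun s t => K (q s) (q t)) c + e * (\sum_s `|c s|) ^+ 2.
Proof.
move=> qs e0.
have [N NK] : exists N : S -> S -> set T * set T, forall s t, [/\ nbhs (q s) (N s t).1,
    nbhs (q t) (N s t).2 &
    forall x y, (N s t).1 x -> (N s t).2 y -> `|K x y - K (q s) (q t)| <= e].
  have /choice[N NK] : forall p : S * S, exists N : set T * set T, [/\ nbhs (q p.1) N.1,
    nbhs (q p.2) N.2 & forall x y, N.1 x -> N.2 y -> `|K x y - K (q p.1) (q p.2)| <= e].
    by move=> [s t]; have [U [V UV]] := Kcont (q s) (q t) e0; exists (U, V).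
  by exists (fun s t => N (s, t)) => s t; exact: NK (s, t).
pose W s := interior (fun x => forall t, (N s t).1 x /\ (N t s).2 x).
have Wopen s : open (W s) by exact: open_interior.
have Wq s : W s (q s).
  apply: filter_forall => t; have [N1 _ _] := NK s t; have [_ N2 _] := NK t s.
  by apply: filterI.
have WK s t x y : W s x -> W t y -> `|K x y - K (q s) (q t)| <= e.
  move=> /interior_subset Wx /interior_subset Wy.
  have [_ _] := NK s t; apply; first by case: (Wx t).
  by case: (Wy s).
(* The neighbourhoods may overlap, so the partition consists of the atoms they generate. *)
pose tau (x : borelType T) : {set S} := [set s | `[< W s x >]]%SET.
have mW s : measurable (W s : set (borelType T)) by exact: sub_sigma_algebra.
have mtau (B : {set S}) : measurable (tau @^-1` [set B]).
  rewrite (_ : tau @^-1` [set B] =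
    \bigcap_(s in [set: S]) (if s \in B then W s else ~` W s)).
    apply: fin_bigcap_measurable => [|s _]; first exact: finite_finset.
    by case: ifP => // _; exact: measurableC.
  apply/seteqP; split=> x /=.
    by move=> <- s _; rewrite inE; case: asboolP.
  move=> xB; apply/setP => s; rewrite inE; have := xB s I.
  by case: ifP => _ Ws; [exact/asboolP | apply/asboolPn].
pose m B := fine (mu (tau @^-1` [set B])).
have mE (s : S) : \sum_(B : {set S} | s \in B) m B = fine (mu (W s)).
  rewrite sum_fine => [|B _]; last exact: fin_num_measure.
  rewrite -(measure_atoms mu mtau (fun B : {set S} => s \in B)); congr (fine (mu _)).
  by apply/funext => x; rewrite /= inE; exact: asboolE.
apply: (@quad_approx R {set S} S (fun s B => s \in B) m
   (fun B C => fine (@block_energy _ (borelType T) R K mu (tau @^-1` [set B]) (tau @^-1` [set C])))).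
- by move=> B; exact: fine_ge0.
- move=> s; rewrite mE fine_gt0 //; apply/andP; split; first exact: qs s _ (Wopen s) (Wq s).
  by rewrite ltey_eq fin_num_measure.
- move=> s t B C sB tC; set u := K (q s) (q t).
  have u0 : 0 <= u by exact: K0.
  (* The lower bound is cut off at 0 because [block_energy_bounds] requires a nonnegative one. *)
  have := @block_energy_bounds _ (borelType T) _ _ K0 mK mu (tau @^-1` [set B]) (tau @^-1` [set C])
    (Num.max 0 (u - e)) (u + e) (mtau B) (mtau C).
  case.
  + by rewrite le_max lexx.
  + move=> x y /= xB yC; have : `|K x y - u| <= e.
      by apply: WK; apply/asboolP; [move: sB | move: tC]; rewrite -?xB -?yC inE.
    by rewrite ge_max K0 /= ler_norml; lra.
  have fB : mu (tau @^-1` [set B]) = (m B)%:E by rewrite fineK // fin_num_measure.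
  have fC : mu (tau @^-1` [set C]) = (m C)%:E by rewrite fineK // fin_num_measure.
  rewrite fB fC -(@fineK _ (block_energy _ _ _ _)); last exact: (@block_energy_fin _ (borelType T) _ _ K0 mK).
  rewrite -!EFinM !lee_fin => lb ub.
  have mm : 0 <= m C * m B by rewrite mulr_ge0 // fine_ge0.
  have mx : u - e <= Num.max 0 (u - e) by rewrite le_max lexx orbT.
  have := ler_wpM2r mm mx; rewrite ler_norml; lra.
- move=> v; exact: (@minimizer_quad_ge0 _ (borelType T) _ _ K0 mK mu _ tau K1 mtau mu_min).
Qed.

Lemma support_quad_ge0 (S : finType) (q : S -> T) (c : S -> R) :
  (forall s, measure_support mu (q s)) -> 0 <= quad (fun s t => K (q s) (q t)) c.
Proof.
move=> qs; apply/ler_addgt0Pr => e e0.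
set C := (\sum_s `|c s|) ^+ 2; have C0 : 0 <= C by exact: sqr_ge0.
have C1 : 0 < 1 + C by lra.
have e1 : 0 < e / (1 + C) by rewrite divr_gt0.
apply: le_trans (support_quad_ge0_approx c qs e1) _; rewrite lerD2l -/C.
by rewrite mulrAC ler_pdivrMr // ler_pM2l //; lra.
Qed.

End SupportPositivity.

(** * The kernel on the sphere *)

(** Away from 0 the power is differentiable; at 0, |s| < e^(1/p) gives |s|^p < e. *)
Lemma continuous_normr_powR (R : realType) (p : R) : 0 < p ->
  continuous (fun r : R => `|r| `^ p).
Proof.
move=> p0 r; have [->|r0] := eqVneq r 0; last first.
  apply: (@continuous_comp _ _ _ (fun r : R => `|r|) (fun s => s `^ p)).
    exact: norm_continuous.
  apply: differentiable_continuous; apply/derivable1_diffP; apply: derivable_powR.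
  by rewrite in_itv /= andbT normr_gt0.
apply/cvgrPdist_lt => e e0; rewrite normr0 powR0 ?gt_eqF //.
have small : \forall s \near (0 : R), `|s| < e `^ p^-1 by apply: nbhs0_lt; exact: powR_gt0.
apply: filterS small => s small; rewrite sub0r normrN ger0_norm ?powR_ge0 //.
have -> : e = (e `^ p^-1) `^ p by rewrite -powRrM mulVf ?gt_eqF // powRr1 // ltW.
by apply: gt0_ltr_powR => //; rewrite ?nnegrE ?powR_ge0.
Qed.

Lemma continuous_coordinate (R : realType) (n : nat) (i : 'I_n.+1) :
  continuous (fun x : sphere R n => \val x 0 i).
Proof.
move=> x; apply: (@continuous_comp _ _ _ (\val : sphere R n -> 'rV[R]_n.+1) (fun u => u 0 i)).
  exact: initial_continuous.
exact: coord_continuous.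
Qed.

Lemma measurable_of_continuous (R : realType) (T : ptopologicalType) (f : T -> R) :
  continuous f -> measurable_fun [set: borelType T] (f : borelType T -> R).
Proof.
move=> fc; apply: (measurability _ (RGenOInfty.measurableE R)) => _ [_ [x ->] <-].
rewrite setTI; apply: sub_sigma_algebra; apply: open_comp => [y _|]; first exact: fc.
exact: interval_open.
Qed.

Section SphereKernel.
Variables (R : realType) (n : nat) (p : R).
Hypothesis p0 : 0 < p.
Definition sphere_kernel (x y : sphere R n) : R := `|dot (\val x) (\val y)| `^ p.

Lemma dot_sphere (x : sphere R n) : dot (\val x) (\val x) = 1.
Proof. by have := valP x; rewrite inE. Qed.

(** The squared length of x - e y is nonnegative for e = 1 and e = -1. *)
Lemma dot_sphere_le1 (x y : sphere R n) : `|dot (\val x) (\val y)| <= 1.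
Proof.
suff H (e : R) : e ^+ 2 = 1 -> e * dot (\val x) (\val y) <= 1.
  by have := H 1 (expr1n _ _); have := H (-1); rewrite sqrrN expr1n => /(_ erefl);
     rewrite ler_norml; lra.
move=> e2; have : 0 <= \sum_i (\val x 0 i - e * \val y 0 i) ^+ 2.
  by apply: sumr_ge0 => i _; exact: sqr_ge0.
have -> : \sum_i (\val x 0 i - e * \val y 0 i) ^+ 2 =
    dot (\val x) (\val x) - 2 * (e * dot (\val x) (\val y)) + e ^+ 2 * dot (\val y) (\val y).
  rewrite /dot !mulr_sumr -sumrB -big_split; apply: eq_bigr => i _ /=; ring.
by rewrite !dot_sphere e2; lra.
Qed.

Lemma sphere_kernel_ge0 x y : 0 <= sphere_kernel x y.
Proof. exact: powR_ge0. Qed.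

Lemma sphere_kernel_le1 x y : sphere_kernel x y <= 1.
Proof.
have -> : 1 = 1 `^ p :> R by rewrite powR1.
by apply: ge0_ler_powR; rewrite ?nnegrE ?dot_sphere_le1 // ltW.
Qed.

Lemma measurable_sphere_kernel :
  measurable_fun [set: borelType (sphere R n) * borelType (sphere R n)]
    (fun z => sphere_kernel z.1 z.2).
Proof.
pose g (z : borelType (sphere R n) * borelType (sphere R n)) : R :=
  dot (\val (z.1 : sphere R n)) (\val (z.2 : sphere R n)).
suff mg : measurable_fun setT g.
  have := measurableT_comp (@measurable_powR R p) (measurableT_comp (@normr_measurable R setT) mg).
  exact.
apply: measurable_sum => i; apply: measurable_funM.
  apply: (@measurableT_comp _ _ _ _ (borelType (sphere R n)) _ (fun x => \val x 0 i)) => //.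
  by apply: measurable_of_continuous; exact: continuous_coordinate.
apply: (@measurableT_comp _ _ _ _ (borelType (sphere R n)) _ (fun x => \val x 0 i)) => //.
by apply: measurable_of_continuous; exact: continuous_coordinate.
Qed.

Lemma sphere_kernel_continuity x y (e : R) : 0 < e ->
  exists U V : set (sphere R n), [/\ nbhs x U, nbhs y V &
    forall x' y', U x' -> V y' -> `|sphere_kernel x' y' - sphere_kernel x y| <= e].
Proof.
move=> e0; pose r := dot (\val x) (\val y).
have dc : continuous (fun z : sphere R n * sphere R n => dot (\val z.1) (\val z.2)).
  apply: continuous_big; first exact: add_continuous.
  move=> i _ z; apply: cvgM.
    apply: (@continuous_comp _ _ _ fst (fun x : sphere R n => \val x 0 i)).
      exact: cvg_fst.
    exact: continuous_coordinate.
  apply: (@continuous_comp _ _ _ snd (fun x : sphere R n => \val x 0 i)).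
    exact: cvg_snd.
  exact: continuous_coordinate.
have near_r : \forall s \near r, `| `|r| `^ p - `|s| `^ p | < e.
  by have /cvgrPdist_lt /(_ e e0) := @continuous_normr_powR R p p0 r.
have [[U V] /= [xU yV] UV] := dc (x, y) _ near_r.
exists U, V; split=> // x' y' Ux Vy; rewrite distrC ltW //.
exact: UV (x', y') _.
Qed.
End SphereKernel.

(** Infinitely many points share one sign pattern of coordinates; for two of them all products of
    coordinates are nonnegative, and one is positive. *)
Lemma sphere_infinite_acute (R : realType) (n : nat) (A : set (sphere R n)) :
  infinite_set A -> exists z : nat -> sphere R n,
    [/\ injective z, forall k, A (z k) & forall j k, 0 < dot (\val (z j)) (\val (z k))].
Proof.
move=> Ainf.
pose sg (x : sphere R n) : {ffun 'I_n.+1 -> bool * bool} :=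
  [ffun i => (0 < \val x 0 i, \val x 0 i < 0)].
have [c cinf] : exists c, infinite_set (A `&` sg @^-1` [set c]).
  apply/existsNP => fin; apply: Ainf.
  rewrite (_ : A = \bigcup_(c in [set: {ffun 'I_n.+1 -> bool * bool}]) (A `&` sg @^-1` [set c])).
    by apply: bigcup_finite => // c _; apply: contrapT; exact: fin.
  by apply/seteqP; split=> [x Ax | x [c _ []]] //; exists (sg x).
have /infiniteP/pcard_leP/injfunPex[z zA zinj] := cinf.
exists z; split=> [j k /zinj|k|j k]; first by apply; rewrite inE.
  by case: (zA k I).
have /ffunP sgE : sg (z j) = sg (z k).
  by case: (zA j I) => _ /= ->; case: (zA k I).
have prod i : \val (z j) 0 i != 0 -> 0 < \val (z j) 0 i * \val (z k) 0 i.
  move=> j0; have := sgE i; rewrite !ffunE; case=> pos neg.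
  case: (ltgtP 0 (\val (z j) 0 i)) j0 pos neg => // zji _ /esym pos /esym neg.
    exact: mulr_gt0.
  by rewrite nmulr_rgt0.
have prod0 i : 0 <= \val (z j) 0 i * \val (z k) 0 i.
  by have [->|/prod/ltW //] := eqVneq (\val (z j) 0 i) 0; rewrite mul0r.
have [i j0] : exists i, \val (z j) 0 i != 0.
  apply/existsP; apply: contraT; rewrite negb_exists => /forallP j0.
  have := dot_sphere (z j); rewrite /dot big1 => [/esym/eqP|i _]; first by rewrite oner_eq0.
  by have := j0 i; rewrite negbK => /eqP ->; rewrite mul0r.
by rewrite /dot (bigD1 i) //= ltr_pwDl ?prod // sumr_ge0.
Qed.

Lemma nat_ultrafilter : exists G : set_system nat,
  UltraFilter G /\ forall m, G [set n | n <> m].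
Proof.
have [G [GU evG]] := ultraFilterLemma (eventually_filter).
exists G; split=> // m; apply: evG; exists m.+1 => // n /= mn nm.
by rewrite nm ltnn in mn.
Qed.

Lemma powR_ratio (R : realType) (a b : nat) (s : R) : 0 <= s -> (0 < b)%N ->
  (s `^ (a%:R / b%:R)) ^+ b = s ^+ a.
Proof.
move=> s0 b0; rewrite -powR_mulrn ?powR_ge0 // -powRrM divfK ?powR_mulrn //.
by rewrite pnatr_eq0 -lt0n.
Qed.

(** * Finiteness of the support for p = a / b *)

Lemma minimizer_finite_support (R : realType) (n a b : nat)
    (mu : borel_probability (sphere R n) R) :
  (0 < a)%N -> coprime a b -> (n < b)%N ->
  p_frame_minimizers (a%:R / b%:R) mu -> finite_set (measure_support mu).
Proof.
move=> a0 ab nb mu_min; set p := a%:R / b%:R : R in mu_min.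
have b0 : (0 < b)%N by exact: leq_ltn_trans nb.
have p0 : 0 < p by rewrite divr_gt0 ?ltr0n.
apply: contrapT => /sphere_infinite_acute [z [zinj zsupp zpos]].
pose c k := dot (\val (z k)) (\val (z 0)).
have c0 k : 0 < c k by exact: zpos.
pose x k (i : 'I_n.+1) : R := \val (z k) 0 i / c k.
have xE j k : \sum_i x j i * x k i = dot (\val (z j)) (\val (z k)) / (c j * c k).
  rewrite /dot mulr_suml; apply: eq_bigr => i _; rewrite /x.
  by field; rewrite !gt_eqF.
have xpos j k : 0 < \sum_i x j i * x k i by rewrite xE divr_gt0 ?mulr_gt0.
have dotC u v : dot (\val (z u)) (\val (z v)) = dot (\val (z v)) (\val (z u)).
  by apply: eq_bigr => i _; rewrite mulrC.
pose g j k := (\sum_i x j i * x k i) `^ p.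
have x0 k : \sum_i x 0 i * x k i = 1.
  rewrite xE dotC -/(c k) {2}/c dot_sphere mul1r divff // gt_eqF //.
have [G [GU Gne]] := nat_ultrafilter; have GP := @ultra_proper _ _ GU.
apply: (@GenericPoint.no_power_kernel R n.+1 a b x g 0 G) => //.
- by move=> A B AB; apply: filterS.
- by move=> A B GA GB; exact: filterI.
- by move=> A; exact: in_ultra_setVsetC.
- by move=> A; exact: filter_ex.
(* As x_j . x_j = 1 / c_j^2, the rescaled vector determines its scaling factor. *)
- move=> j k xjk; apply: zinj; apply: val_inj; apply/rowP => i.
  have cjk : c j = c k.
    have := xE j j; have := xE k k; rewrite xjk !dot_sphere => -> /eqP.
    rewrite !mul1r (inj_eq GRing.invr_inj) -!expr2 eqrXn2 ?ltW // => /eqP //.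
  have : x j i = x k i by rewrite xjk.
  by rewrite /x cjk => /mulIf; apply; rewrite invr_neq0 ?gt_eqF.
- split=> [j k|S q v]; first by rewrite /g; congr powR; apply: eq_bigr => i _; rewrite mulrC.
  (* Rescaling divides the kernel by (c_j c_k)^p, which the weights absorb. *)
  have := @support_quad_ge0 R (sphere R n) (sphere_kernel p) (@sphere_kernel_ge0 R n p)
    (sphere_kernel_le1 p0) (@measurable_sphere_kernel R n p) (sphere_kernel_continuity p0)
    mu mu_min S (fun s => z (q s)) (fun s => v s / c (q s) `^ p) (fun s => zsupp (q s)).
  congr (0 <= _); apply: eq_bigr => s _; apply: eq_bigr => t _.
  have cp k : c k `^ p != 0 by rewrite gt_eqF // powR_gt0.
  have -> : sphere_kernel p (z (q s)) (z (q t)) = g (q s) (q t) * (c (q s) `^ p * c (q t) `^ p).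
    rewrite /g -!powRM ?mulr_ge0 // ?ltW // xE divfK ?mulf_neq0 ?gt_eqF //.
    by rewrite /sphere_kernel gtr0_norm.
  by field; rewrite !cp.
- by move=> k; rewrite /g; under eq_bigr do rewrite mulrC; rewrite x0 powR1.
- by move=> j k; rewrite /g powR_ratio // ltW.
Qed.

(** * Density of the dyadic exponents *)

Lemma dyadic_approx (R : realType) (d : nat) (x e : R) : 0 < x -> 0 < e ->
  exists k j, (d <= 2 ^ k)%N /\ `|x - (j.*2.+1)%:R / (2 ^ k)%:R| < e.
Proof.
(* Since 2^k > k, this k gives both d <= 2^k and 1 / 2^k < e. *)
move=> x0 e0; pose k := maxn d (Num.truncn e^-1).+1.
pose b := (2 ^ k)%N; have kb : (k < b)%N by exact: ltn_expl.
have b0 : 0 < b%:R :> R by rewrite ltr0n; exact: leq_ltn_trans kb.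
have be : b%:R^-1 < e.
  rewrite invf_plt ?posrE //; apply: lt_le_trans (truncnS_gt _) _.
  by rewrite ler_nat; apply: leq_trans (ltnW kb); rewrite leq_maxr.
exists k, (Num.truncn (x * b%:R / 2)); split.
  by apply: leq_trans (ltnW kb); rewrite leq_maxl.
(* Here x b lies in [2j, 2j + 2), so the odd integer 2j + 1 is within 1 of it. *)
set j := Num.truncn _; rewrite -/b.
have xb0 : 0 <= x * b%:R / 2 by rewrite divr_ge0 ?mulr_ge0 // ltW.
have := truncn_itv xb0; rewrite -/j => /andP[]; rewrite -[j.+1]addn1 natrD => lo hi.
have -> : x - (j.*2.+1)%:R / b%:R = (x * b%:R - (j.*2.+1)%:R) / b%:R.
  by field; rewrite gt_eqF.
rewrite normrM normfV (gtr0_norm b0); apply: le_lt_trans be.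
rewrite -[leRHS]mul1r ler_pM2r ?invr_gt0 // -[j.*2.+1]addn1 natrD -muln2 natrM ler_norml; lra.
Qed.

Lemma dyadic_finite_support (R : realType) (d k j : nat) : (0 < d)%N -> (0 < k)%N ->
  (d <= 2 ^ k)%N ->
  finite_support_exponents d ((j.*2.+1)%:R / (2 ^ k)%:R : R).
Proof.
move=> d0 k0 dk; have b0 : (0 < 2 ^ k)%N by rewrite expn_gt0.
split; first by rewrite divr_gt0 ?ltr0n.
  (* If p were 2m, the odd numerator would equal 2m 2^k. *)
  case=> m _ /(congr1 (fun r => r * (2 ^ k)%:R)) /eqP.
  rewrite divfK ?pnatr_eq0 -?lt0n // -natrM eqr_nat => /eqP /(congr1 odd).
  by rewrite /= oddM oddM odd_double.
move=> mu; apply: minimizer_finite_support => //; last by rewrite prednK.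
by rewrite coprimeXr // coprimen2 /= odd_double.
Qed.

Theorem corollary3p3 (R : realType) (d : nat) (hd : (2 <= d)%N) :
  dense [set p : set_type (`]0, +oo[ : set R) |
    finite_support_exponents d (\val p)].
Proof.
move=> O [x Ox] Oopen; have [A Aopen AO] := Oopen.
have x0 : 0 < \val x by have := valP x; rewrite inE /= in_itv /= andbT.
have [e /= e0 eA] : exists2 e : R, 0 < e & ball (\val x) e `<=` A.
  by apply/nbhs_ballP; apply: open_nbhs_nbhs; split=> //; move: Ox; rewrite -AO.
have [k [j [dk near]]] := dyadic_approx d x0 e0.
have k0 : (0 < k)%N.
  by case: k dk {near} => // dk; rewrite expn0 leqNgt hd in dk.
have py : (j.*2.+1)%:R / (2 ^ k)%:R \in (`]0, +oo[%classic : set R).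
  by rewrite inE /= in_itv /= andbT divr_gt0 // ltr0n // expn_gt0.
pose P r : Prop := r \in (`]0, +oo[%classic : set R).
exists (exist P _ py); split; first by rewrite -AO; exact: eA.
by apply: dyadic_finite_support => //; exact: ltnW.
Qed.
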